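(* There is a deterministic distributed algorithm in the LOCAL model that, on any $n$-node graph with maximum degree $\Delta$, computes a proper edge coloring with $3\Delta/2$ colors in $O(\Delta^2\cdot\log n)$ rounds.
   Context: LOCAL model: the network is an $n$-node simple graph whose nodes have unique IDs; computation proceeds in synchronous rounds, in each of which every node may perform arbitrary local computation and send a message of arbitrary size to each neighbor. The running time is the number of rounds until every node has produced its output (here, the colors of its incident edges). A proper edge coloring assigns colors to edges so that any two edges sharing an endpoint receive different colors.
   Formalization: The unique IDs are assumed to lie in {1,…,n^c} for an arbitrary constant c, on which the algorithm and the O-constant may depend (with unbounded IDs the claim fails already on cycles); nodes initially know n and Δ, and 3Δ/2 is read as its floor. *)

(* Defs.v *)
From HB Require Import structures.
From mathcomp Require Import all_boot.

Set Implicit Arguments.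
Unset Strict Implicit.
Unset Printing Implicit Defensive.

Section Graph.
Variables (T : finType) (e : rel T).

Definition simple_graph : Prop := symmetric e /\ irreflexive e.

Definition degree (v : T) : nat := #|[set u | e v u]|.

Definition max_degree : nat := \max_(v : T) degree v.

Definition edges : {set {set T}} :=
  [set [set p.1; p.2] | p : T * T & e p.1 p.2].

(* The colors are 0, ..., k - 1; the values of [col] outside [edges] are
   irrelevant (a codomain 'I_k would exclude edgeless graphs with k = 0). *)
Definition proper_edge_coloring (k : nat) (col : {set T} -> nat) : Prop :=
  (forall E, E \in edges -> col E < k) /\
  (forall E F, E \in edges -> F \in edges -> E != F -> E :&: F != set0 ->
     col E != col F).

(* The IDs are pairwise distinct elements of {1, ..., N}. *)
Definition unique_ids (N : nat) (id : T -> nat) : Prop :=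
  injective id /\ forall v, 0 < id v <= N.

(* [ports v] lists the neighbors of [v] without repetition; the neighbor at
   position i is the one reached through port i of [v]. *)
Definition port_numbering (ports : T -> seq T) : Prop :=
  forall v, uniq (ports v) /\ ports v =i [pred u | e v u].

End Graph.

(* A deterministic LOCAL algorithm with node outputs in [O], i.e. the program
   run by every node.  Local computation is arbitrary (any function), and
   states and messages range over arbitrary types, so that neither the local
   memory nor the message size is bounded. *)
Record local_algorithm (O : Type) : Type := LocalAlgorithm {
  state : Type;
  message : Type;
  (* the number of nodes, the maximum degree, the node's ID and its degree *)
  init : nat -> nat -> nat -> nat -> state;
  (* the message sent through a given port *)
  send : state -> nat -> message;
  (* the new state, given the received messages in the order of the ports *)
  receive : state -> seq message -> state;
  output : state -> option O;
  (* A node that has produced its output may go on communicating, but it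
     cannot change its output. *)
  output_final : forall s ms o,
    output s = Some o -> output (receive s ms) = Some o
}.

Section Execution.
Variables (O : Type) (A : local_algorithm O).
Variables (T : finType) (e : rel T) (ports : T -> seq T) (id : T -> nat).

(* For a neighbor [u] of [v], [index v (ports u)] is the port of [u] that leads
   to [v]. *)
Fixpoint state_after (t : nat) (v : T) : state A :=
  if t is t'.+1 then
    receive (state_after t' v)
      [seq send (state_after t' u) (index v (ports u)) | u <- ports v]
  else init A #|T| (max_degree e) (id v) (degree e v).

Definition output_after (t : nat) (v : T) : option O :=
  output (state_after t v).

End Execution.

(* Within [t] rounds every node has output the list, in the order of its ports,
   of the colors of its incident edges, for a common proper edge coloring with
   [k] colors. *)
Definition edge_colors_within (A : local_algorithm (seq nat)) (T : finType)
    (e : rel T) (ports : T -> seq T) (id : T -> nat) (k t : nat) : Prop :=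
  exists2 col : {set T} -> nat, proper_edge_coloring e k col &
    forall v, output_after A e ports id t v
              = Some [seq col [set v; u] | u <- ports v].

(* Main.v *)
(* The colors are used up three at a time: three new matchings are removed
   from the graph so that the maximum degree d drops by 2, within O(d log n)
   rounds; d / 2 such steps, and one more color if d is odd, give the bound.

   Hall matchings. In a bipartite graph whose left sets expand by a factor 1 +
   1/D, every left vertex lies, within distance O(D log n), among the users of
   a set of right vertices that can be matched so as to saturate all its
   users. If every left vertex obeys the least such set (in a global order),
   the choices are consistent without any coordination.

   One step. A maximal matching of the vertices of degree d, with a Hall
   matching of those it leaves exposed, followed by a maximal matching of the
   vertices that still have residual degree d - 1, is a system P of paths and
   cycles. The needy vertices, of residual degree d - 1 with respect to P, are
   independent and have degree at most 1 in P, while every other vertex has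
   residual degree at most d - 2; hence another Hall matching Q, with
   expansion (d - 1) / (d - 2), gives each needy vertex an edge, of color 3,
   to a vertex that is not needy. Call a vertex touched if it is covered by Q.
   An edge of P between two untouched vertices may get color 3, and an edge of
   P between two touched non-needy vertices may be dropped, so that P can be
   cut at any edge with equally touched non-needy ends. The pieces that remain
   after a maximal set of cuts alternate between touched and untouched
   vertices, so they have no odd cycle and can be colored 1, 2 once they are
   bounded. To bound them, the vertices of sparse windows of P also take part
   in the Hall matching, in such a way that each window keeps an untouched
   vertex in each parity class and thus does not alternate. *)
Require Import Defs.
From HB Require Import structures.
From mathcomp Require Import all_boot zify.

Set Implicit Arguments.
Unset Strict Implicit.
Unset Printing Implicit Defensive.

(** * Graphs as neighborhood functions, balls, and local functions of a graph *)

Definition graph (V : finType) := V -> {set V}.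

Definition sgraph (V : finType) (g : graph V) : Prop :=
  (forall x y, (y \in g x) = (x \in g y)) /\ (forall x, x \notin g x).

Definition symg (V : finType) (g : graph V) : Prop :=
  forall x y, (y \in g x) = (x \in g y).

Section Ball.
Variable V : finType.
Implicit Types (g : graph V) (x y z : V).

Fixpoint ball g t x : {set V} :=
  if t is t'.+1 then \bigcup_(y in ball g t' x) (y |: g y) else [set x].

Lemma ball_refl g t x : x \in ball g t x.
Proof.
elim: t => [|t IH] /=; first by rewrite inE.
by apply/bigcupP; exists x => //; rewrite setU11.
Qed.

Lemma ball_step g t x y z : y \in ball g t x -> z \in g y -> z \in ball g t.+1 x.
Proof. by move=> yb zy /=; apply/bigcupP; exists y => //; rewrite inE zy orbT. Qed.

Lemma ballS g t x : ball g t x \subset ball g t.+1 x.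
Proof. by apply/subsetP => y yb /=; apply/bigcupP; exists y => //; rewrite setU11. Qed.

Lemma ball_le g s t x : s <= t -> ball g s x \subset ball g t x.
Proof.
move=> /subnK <-; elim: (t - s) => [|k IH] //.
by rewrite addSn; apply: subset_trans IH (ballS _ _ _).
Qed.

Lemma ball_leP g s t x y : s <= t -> y \in ball g s x -> y \in ball g t x.
Proof. by move=> le_st; apply/subsetP/ball_le. Qed.

Lemma ballSP g t x z :
  reflect (exists2 y, y \in ball g t x & z = y \/ z \in g y) (z \in ball g t.+1 x).
Proof.
apply: (iffP bigcupP) => [[y yb]|[y yb zy]].
  by rewrite !inE => /orP[/eqP ->|zy]; exists y => //; [left|right].
by exists y => //; rewrite !inE; case: zy => ->; rewrite ?eqxx ?orbT.
Qed.

Lemma ball_trans g s t x y z :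
  y \in ball g t x -> z \in ball g s y -> z \in ball g (s + t) x.
Proof.
move=> yb; elim: s z => [|s IH] z; first by rewrite inE => /eqP ->.
case/ballSP => w wb [->|zw]; last exact: ball_step (IH _ wb) zw.
exact: subsetP (ballS _ _ _) _ (IH _ wb).
Qed.

Lemma ball_nbr g x y : y \in g x -> y \in ball g 1 x.
Proof. by move=> yx; apply: ball_step yx; apply: ball_refl. Qed.

Lemma ball_sym g t x y : symg g -> y \in ball g t x -> x \in ball g t y.
Proof.
move=> gs; elim: t y => [|t IH] y; first by rewrite !inE eq_sym.
case/ballSP => w wb [->|yw]; first exact: subsetP (ballS _ _ _) _ (IH _ wb).
by rewrite -addn1; apply: ball_trans (IH _ wb); apply: ball_nbr; rewrite gs.
Qed.

Definition subgraph (h g : graph V) := forall x, h x \subset g x.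

Lemma ball_subgraph h g t x : subgraph h g -> ball h t x \subset ball g t x.
Proof.
move=> hg; elim: t => [|t IH] //.
apply/subsetP => z /ballSP[y yb yz]; apply/ballSP; exists y; first exact: (subsetP IH).
by case: yz => [->|/(subsetP (hg y))]; [left|right].
Qed.

(** Whole rows are compared, so the edges leaving the ball are seen too. This is what [t + 1] rounds
    of communication reveal, and it is why [agree_ball] gains one unit of distance. *)
Definition agree t g g' x := {in ball g t x, g =1 g'}.

Lemma agree_le s t g g' x : s <= t -> agree t g g' x -> agree s g g' x.
Proof. by move=> le_st ag y /(ball_leP le_st); apply: ag. Qed.

Lemma agree_sub s t g g' x y :
  agree (s + t) g g' x -> y \in ball g t x -> agree s g g' y.
Proof. by move=> ag yb z zb; apply: ag; apply: ball_trans yb zb. Qed.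

Lemma agree_ball t g g' x : agree t g g' x -> ball g t.+1 x = ball g' t.+1 x.
Proof.
elim: t => [|t IH] ag.
  by rewrite /= !big_set1 (ag x) // inE.
have ag' : agree t g g' x by apply: agree_le ag.
rewrite [LHS]/= [RHS]/= -/(ball g t.+1 x) -/(ball g' t.+1 x) (IH ag').
by apply: eq_bigr => y; rewrite -(IH ag') => yb; rewrite (ag y yb).
Qed.

Lemma agree_ball_le s t g g' x :
  agree t g g' x -> s <= t.+1 -> ball g s x = ball g' s x.
Proof.
case: s => [|s] // ag le_st; apply: agree_ball; exact: agree_le ag.
Qed.

Lemma agree_sym t g g' x : agree t g g' x -> agree t g' g x.
Proof.
move=> ag y; rewrite -(agree_ball_le ag (leqnSn _)) => yb.
by rewrite (ag y yb).
Qed.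

(** The counterpart of a [t]-round computation: [F g x] is determined by the rows of [g] within
    distance [t] of [x]. The class [cls] lets [F] behave arbitrarily on graphs outside the
    promise. *)
Definition local (cls : graph V -> Prop) t (D : Type) (F : graph V -> V -> D) :=
  forall g g' x, cls g -> cls g' -> agree t g g' x -> F g x = F g' x.

Lemma local_le cls s t D (F : graph V -> V -> D) :
  s <= t -> local cls s F -> local cls t F.
Proof. by move=> le_st lF g g' x cg cg' ag; apply: lF => //; apply: agree_le ag. Qed.

Lemma local_near cls s t D (F : graph V -> V -> D) g g' x y :
  local cls s F -> cls g -> cls g' -> agree (s + t) g g' x ->
  y \in ball g t x -> F g y = F g' y.
Proof. by move=> lF cg cg' ag yb; apply: lF => //; apply: agree_sub ag yb. Qed.

Lemma local_row cls : local cls 0 (fun g => g).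
Proof. by move=> g g' x _ _; apply; rewrite inE. Qed.

End Ball.

(* Simulation of an algorithm on a derived graph [B g], each vertex [w] of which
   is simulated by the vertex [h w] of [g]. *)
Lemma local_host (V W : finType) (h : W -> V) (B : graph V -> graph W)
    (cls : graph V -> Prop) (cls' : graph W -> Prop) s c t (D : Type)
    (F : graph W -> W -> D) g g' w :
  (forall g, cls g -> cls' (B g)) ->
  (forall g g' w, cls g -> cls g' -> agree s g g' (h w) -> B g w = B g' w) ->
  (forall g w w', cls g -> w' \in B g w -> h w' \in ball g c (h w)) ->
  local cls' t F -> cls g -> cls g' -> agree (s + c * t) g g' (h w) ->
  F (B g) w = F (B g') w.
Proof.
move=> clsB rowB nearB lF cg cg' ag; apply: lF; [exact: clsB..|].
have near k : forall w', w' \in ball (B g) k w -> h w' \in ball g (c * k) (h w).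
  elim: k => [|k IH] w'; first by rewrite inE => /eqP ->; rewrite muln0 inE.
  case/ballSP => w1 /IH w1b [->|/(nearB _ _ _ cg) w1w'].
    by apply: ball_leP w1b; rewrite leq_mul2l leqnSn orbT.
  by rewrite mulnS; apply: ball_trans w1b w1w'.
by move=> w' /near; move=> w'b; apply: rowB => //; apply: agree_sub ag w'b.
Qed.

(** The case of [local_host] in which each vertex simulates itself: radius [s] yields a row of
    [h g], and the edges of [h g], being edges of [g], cost one unit each. *)
Lemma local_sub (V : finType) (cls cls' : graph V -> Prop) s t (D : Type)
    (h : graph V -> graph V) (F : graph V -> V -> D) :
  (forall g, cls g -> cls' (h g)) -> (forall g, cls g -> subgraph (h g) g) ->
  local cls s h -> local cls' t F -> local cls (s + t) (fun g => F (h g)).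
Proof.
move=> clsh sub lh lF g g' x cg cg' ag.
apply: (@local_host V V id h cls cls' s 1 t D F) => //.
- by move=> g1 w w' cg1 w'w; apply: ball_nbr; apply: (subsetP (sub _ cg1 _)).
- by rewrite mul1n.
Qed.


(** * Hall's theorem, and Hall matchings that can be found locally *)

Section Hall.
Variables (L R : finType).
Implicit Types (e : L -> {set R}) (S : {set L}) (T : {set R}).

Definition nbrs e S : {set R} := \bigcup_(l in S) e l.

Lemma nbrsP e S r : reflect (exists2 l, l \in S & r \in e l) (r \in nbrs e S).
Proof. exact: bigcupP. Qed.

Lemma nbrsS e S S' : S \subset S' -> nbrs e S \subset nbrs e S'.
Proof.
move=> sSS'; apply/subsetP => r /nbrsP[l lS rl]; apply/nbrsP.
by exists l => //; apply: (subsetP sSS').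
Qed.

(* Rado's argument: an edge can be deleted at every vertex of degree two or
   more, so a minimal family satisfying Hall's condition consists of
   singletons. *)
Lemma Hall e (A : {set L}) :
  (forall S, S \subset A -> #|S| <= #|nbrs e S|) ->
  exists2 f : L -> option R,
    (forall l, l \in A -> exists2 r, f l = Some r & r \in e l) &
    {in A &, forall l l', f l = f l' -> l = l'}.
Proof.
have [k] := ubnP (\sum_l #|e l|); elim: k e => // k IH e le_k hall.
have [/existsP[l /andP[lA /card_gt1P[x [y [xl yl neq_xy]]]]]|] :=
  boolP [exists l, (l \in A) && (1 < #|e l|)]; last first.
  rewrite negb_exists => /forallP small.
  have card1 l : l \in A -> exists r, e l = [set r].
    move=> lA; apply/cards1P; rewrite eqn_leq leqNgt.
    have:= small l; rewrite lA /= => ->.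
    have:= hall [set l]; rewrite sub1set => /(_ lA).
    by rewrite cards1 /nbrs big_set1.
  exists (fun l => [pick r in e l]) => [l lA|l l' lA l'A].
    by have [r ->] := card1 l lA; exists r; rewrite ?inE //;
       case: pickP => [z /set1P ->|/(_ r)] //; rewrite inE eqxx.
  have [r er] := card1 l lA; have [r' er'] := card1 l' l'A; rewrite er er'.
  case: pickP => [z /set1P ->|/(_ r)]; last by rewrite inE eqxx.
  case: pickP => [z' /set1P ->|/(_ r')]; last by rewrite inE eqxx.
  case=> rr'; apply/eqP/negPn/negP => neq_ll'.
  have := hall [set l; l']; rewrite subUset !sub1set lA l'A => /(_ isT).
  rewrite cards2 neq_ll' /nbrs bigcup_setU !big_set1 er er' rr' setUid cards1.
  by [].
pose del z := fun l' => if l' == l then e l :\ z else e l'.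
have sub_del z l' : del z l' \subset e l'.
  by rewrite /del; case: eqP => [->|] //; apply: subsetDl.
have delE z S : nbrs (del z) S =
    if l \in S then nbrs e (S :\ l) :|: (e l :\ z) else nbrs e S.
  case: ifP => lS; apply/setP => r.
    rewrite inE; apply/nbrsP/orP => [[l' l'S]|[/nbrsP[l' ]|rl]].
    - rewrite /del; case: eqP => [_ ->|/eqP neq rl']; [by right|left].
      by apply/nbrsP; exists l' => //; rewrite !inE neq.
    - rewrite !inE => /andP[neq l'S] rl'; exists l' => //.
      by rewrite /del (negPf neq).
    - by exists l => //; rewrite /del eqxx.
  apply/nbrsP/nbrsP => -[l' l'S rl']; exists l' => //; move: rl'; rewrite /del;
    by case: eqP => // ll'; rewrite -ll' l'S in lS.
have [hx|/forallPn[S1]] :=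
    boolP [forall S : {set L}, (S \subset A) ==> (#|S| <= #|nbrs (del x) S|)].
- have [] := IH (del x).
  + rewrite -ltnS; apply: leq_trans le_k; rewrite ltnS.
    rewrite [X in _ < X](bigD1 l) //= [X in X < _](bigD1 l) //= {1}/del eqxx.
    rewrite [X in _ < X + _](cardsD1 x) xl add1n ltnS leq_add2l.
    by apply: leq_sum => l' /negPf neq; rewrite /del neq.
  + by move=> S SA; apply: implyP (forallP hx S) SA.
  move=> f f1 f2; exists f => // l' /f1[r -> rl']; exists r => //.
  exact: subsetP (sub_del _ _) _ rl'.
rewrite negb_imply -ltnNge => /andP[S1A lt1].
have [hy|/forallPn[S2]] :=
    boolP [forall S : {set L}, (S \subset A) ==> (#|S| <= #|nbrs (del y) S|)].
- have [] := IH (del y).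
  + rewrite -ltnS; apply: leq_trans le_k; rewrite ltnS.
    rewrite [X in _ < X](bigD1 l) //= [X in X < _](bigD1 l) //= {1}/del eqxx.
    rewrite [X in _ < X + _](cardsD1 y) yl add1n ltnS leq_add2l.
    by apply: leq_sum => l' /negPf neq; rewrite /del neq.
  + by move=> S SA; apply: implyP (forallP hy S) SA.
  move=> f f1 f2; exists f => // l' /f1[r -> rl']; exists r => //.
  exact: subsetP (sub_del _ _) _ rl'.
rewrite negb_imply -ltnNge => /andP[S2A lt2].
have lS S z : S \subset A -> #|nbrs (del z) S| < #|S| -> l \in S.
  move=> SA; rewrite delE; case: ifP => // _.
  by rewrite ltnNge hall.
have lS1 := lS _ _ S1A lt1; have lS2 := lS _ _ S2A lt2.
rewrite delE lS1 in lt1; rewrite delE lS2 in lt2.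
(* Submodularity. Since [x] and [y] differ, the union of the two neighborhoods contains that of
   [S1 :|: S2], and their intersection contains that of [(S1 :&: S2) :\ l]. Hall's condition makes
   the total at least [#|S1| + #|S2| - 1], while the two violations make it at most
   [#|S1| + #|S2| - 2]. *)
have := cardsUI (nbrs e (S1 :\ l) :|: (e l :\ x)) (nbrs e (S2 :\ l) :|: (e l :\ y)).
set U := (X in #|X| + _ = _); set I := (X in _ + #|X| = _) => eqUI.
have leU : #|S1 :|: S2| <= #|U|.
  apply: leq_trans (hall (S1 :|: S2) _) _; first by rewrite subUset S1A.
  apply/subset_leq_card/subsetP => r /nbrsP[l'].
  have [->|neq] := eqVneq l' l => [_ rl|].
    by rewrite !inE rl !andbT; case: (eqVneq r x) => [->|_] /=; rewrite ?neq_xy ?orbT.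
  rewrite inE => /orP[] l'S rl'; rewrite !inE; apply/orP; [left|right];
    by apply/orP; left; apply/nbrsP; exists l' => //; rewrite !inE neq.
have leI : #|(S1 :&: S2) :\ l| <= #|I|.
  apply: leq_trans (hall _ _) _.
    by apply: subset_trans (subsetDl _ _) _; apply: subset_trans (subsetIl _ _) S1A.
  apply/subset_leq_card/subsetP => r /nbrsP[l'].
  rewrite !inE => /and3P[neq l'1 l'2] rl'; apply/andP; split; apply/orP; left;
    by apply/nbrsP; exists l' => //; rewrite !inE neq.
have := cardsUI S1 S2; have := cardsD1 l (S1 :&: S2); rewrite !inE lS1 lS2 /=.
lia.
Qed.

End Hall.


(** The first two terms of the binomial expansion are both [D ^ D]. Hence [D] expansions by the
    factor [1 + 1 / D] at least double a set. *)
Lemma double_expn_succ D : 0 < D -> 2 * D ^ D <= D.+1 ^ D.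
Proof.
move=> D0; rewrite -[D.+1]addn1 expnDn.
case: D D0 => [|D] // _; rewrite big_ord_recl big_ord_recl /= !bin0 !mul1n subn0 exp1n muln1.
rewrite bin1 /bump /= exp1n muln1 addn0 subn1 /= -expnS.
by rewrite addnA addnn -mul2n leq_addr.
Qed.

Section Bipartite.
Variables (L R : finType) (e : L -> {set R}) (D : nat).

(** Double counting of the weight between [S] and its neighborhood: each vertex of [S] emits at
    least [D + 1], each neighbor receives at most [D]. *)
Lemma weight_expand (w : L -> R -> nat) :
  (forall l r, 0 < w l r -> r \in e l) ->
  (forall l, e l != set0 -> D < \sum_r w l r) ->
  (forall r, \sum_l w l r <= D) ->
  forall S : {set L}, (forall l, l \in S -> e l != set0) ->
    D.+1 * #|S| <= D * #|nbrs e S|.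
Proof.
move=> we wl wr S demS.
apply: (@leq_trans (\sum_(l in S) \sum_r w l r)).
  rewrite -sum1_card big_distrr /=; apply: leq_sum => l lS.
  by rewrite muln1; apply/wl/demS.
rewrite exchange_big /= (bigID (mem (nbrs e S))) /= [X in _ + X]big1 ?addn0.
  rewrite -[#|_|]sum1_card big_distrr /=; apply: leq_sum => r _.
  by rewrite muln1; apply: leq_trans (wr r); rewrite [X in _ <= X](bigID (mem S)) leq_addr.
move=> r rN; apply: big1 => l lS; apply/eqP; rewrite -leqn0 leqNgt; apply/negP => /we rl.
by case/negP: rN; apply/nbrsP; exists l.
Qed.

Definition users (T : {set R}) : {set L} := [set l | e l :&: T != set0].

Lemma usersP (T : {set R}) l : reflect (exists2 r, r \in e l & r \in T) (l \in users T).
Proof.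
rewrite inE; apply: (iffP (set0Pn _)) => [[r /setIP[]]|[r rl rT]]; exists r => //.
by apply/setIP.
Qed.

Definition saturates (T : {set R}) (f : L -> option R) :=
  [forall l in users T, [exists r in T, (f l == Some r) && (r \in e l)]]
  && [forall l in users T, forall l' in users T, (f l == f l') ==> (l == l')].

Lemma saturatesP (T : {set R}) f :
  reflect ((forall l, l \in users T -> exists r, [/\ r \in T, f l = Some r & r \in e l]) /\
           {in users T &, injective f}) (saturates T f).
Proof.
apply: (iffP andP) => -[H1 H2]; split.
- move=> l lT; have /existsP[r /and3P[rT /eqP fl rl]] := implyP (forallP H1 l) lT.
  by exists r.
- move=> l l' lT l'T ll'; apply/eqP.
  have := implyP (forallP (implyP (forallP H2 l) lT) l') l'T.
  by rewrite ll' eqxx.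
- apply/forallP => l; apply/implyP => /H1[r [rT fl rl]]; apply/existsP; exists r.
  by rewrite rT fl eqxx.
- apply/forallP => l; apply/implyP => lT; apply/forallP => l'; apply/implyP => l'T.
  by apply/implyP => /eqP /H2 ->.
Qed.

Fixpoint spread k l0 : {set L} :=
  if k is k'.+1 then users (nbrs e (spread k' l0)) else [set l0].

Lemma spread_dem k l0 l : e l0 != set0 -> l \in spread k l0 -> e l != set0.
Proof.
case: k => [|k] dem0; first by rewrite inE => /eqP ->.
by move=> /usersP[r rl _]; apply/set0Pn; exists r.
Qed.

(* The sets saturating their users are closed under union; if the largest one
   near [l0] missed [l0], then the rest of the neighborhood would expand by a
   factor [1 + 1/D] in each step. *)
Lemma saturating_structure q l0 :
  0 < D -> #|L| < 2 ^ q -> e l0 != set0 ->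
  (forall S : {set L}, (forall l, l \in S -> e l != set0) ->
    D.+1 * #|S| <= D * #|nbrs e S|) ->
  exists (T : {set R}) (f : {ffun L -> option R}),
    [/\ T \subset nbrs e (spread (D * q) l0), l0 \in users T & saturates T f].
Proof.
move=> D0 Lq dem0 expand; set X := nbrs e _.
pose good (T : {set R}) := (T \subset X) && [exists f : {ffun L -> option R}, saturates T f].
have good0 : good set0.
  have users0 : users set0 = set0.
    by apply/setP => l; rewrite !inE setI0 eqxx.
  rewrite /good sub0set; apply/existsP; exists [ffun => None].
  by apply/saturatesP; rewrite users0; split=> [l|l l']; rewrite inE.
have [T /andP[TX /existsP[f satT]] maxT] := arg_maxnP (fun T : {set R} => #|T|) good0.
exists T, f; split=> //; apply/negPn/negP => l0T.
have [satf injf] := saturatesP _ _ satT.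
pose rest (T' : {set R}) := users T' :\: users T.
(* A set disjoint from [T] has more new users than elements: otherwise a smallest exception could be
   matched to all its new users and added to [T], against the maximality of [T]. *)
have big_rest (T' : {set R}) : T' \subset X -> T' != set0 -> [disjoint T' & T] ->
    #|T'| < #|rest T'|.
  move=> T'X T'0 T'T; rewrite ltnNge; apply/negP => small.
  pose bad (T' : {set R}) := [&& T' \subset X, T' != set0, [disjoint T' & T] & #|rest T'| <= #|T'|].
  have bad' : bad T' by apply/and4P.
  have [T1 /and4P[T1X T10 T1T small1] minT1] := arg_minnP (fun T : {set R} => #|T|) bad'.
  (* Hall's condition follows from minimality: if [S] violated it, removing the neighborhood of [S]
     from [T1] would leave a smaller exception. *)
  have [S SA|f1 sat1 inj1] := @Hall L R (fun l => e l :&: T1) (rest T1).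
    rewrite leqNgt; apply/negP => viol.
    set N := nbrs _ S in viol.
    have NT1 : N \subset T1.
      by apply/bigcupsP => l _; apply: subsetIr.
    have restD : rest (T1 :\: N) \subset rest T1 :\: S.
      apply/subsetP => l /setDP[/usersP[r rl /setDP[rT1 rN]] lT].
      apply/setDP; split; first by apply/setDP; split=> //; apply/usersP; exists r.
      by apply: contra rN => lS; apply/nbrsP; exists l => //; rewrite inE rl.
    have cN := subset_leq_card NT1.
    have cD : #|T1 :\: N| = #|T1| - #|N| by rewrite cardsD (setIidPr NT1).
    have cR : #|rest (T1 :\: N)| <= #|rest T1| - #|S|.
      by apply: leq_trans (subset_leq_card restD) _; rewrite cardsD (setIidPr SA).
    have cS := subset_leq_card SA.
    have N0 : 0 < #|N|.
      have [l lS] : exists l, l \in S by apply/card_gt0P; apply: leq_ltn_trans viol.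
      have /setDP[/usersP[r rl rT1] _] := subsetP SA l lS.
      by apply/card_gt0P; exists r; apply/nbrsP; exists l => //; rewrite inE rl.
    have badD : bad (T1 :\: N).
      apply/and4P; split.
      - by apply: subset_trans T1X; apply: subsetDl.
      - by rewrite -card_gt0 cD subn_gt0; apply: leq_trans viol _; apply: leq_trans small1.
      - by apply: disjointWl T1T; apply: subsetDl.
      - by rewrite cD; move: cR viol small1; clear; lia.
    by have := minT1 _ badD; rewrite cD; move: N0 cN; clear; lia.
  have goodU : good (T1 :|: T).
    rewrite /good subUset T1X TX; apply/existsP.
    exists [ffun l => if l \in users T then f l else f1 l].
    have users_rest l : l \in users (T1 :|: T) -> l \notin users T -> l \in rest T1.
      move=> /usersP[r rl /setUP[rT1|rT]] lT; last by case/negP: lT; apply/usersP; exists r.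
      by rewrite in_setD lT; apply/usersP; exists r.
    have f1T l l' : l \notin users T -> l \in rest T1 -> l' \in users T -> f l' = f1 l -> False.
      move=> lT /sat1[r -> /setIP[rl rT1]] /satf[r' [r'T -> _]] [] rr'.
      by have /pred0P/(_ r) := T1T; rewrite /= rT1 -rr' r'T.
    apply/saturatesP; split=> [l lU|l l' lU l'U]; rewrite !ffunE.
      case: ifPn => [/satf[r [rT fl rl]]|lT].
        by exists r; split=> //; rewrite inE rT orbT.
      have [r fl /setIP[rl rT1]] := sat1 _ (users_rest _ lU lT).
      by exists r; split=> //; rewrite inE rT1.
    case: ifPn => lT; case: ifPn => l'T.
    - exact: injf.
    - by move=> fl; case: (f1T _ _ l'T (users_rest _ l'U l'T) lT fl).
    - by move=> fl; case: (f1T _ _ lT (users_rest _ lU lT) l'T (esym fl)).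
    - exact: inj1 (users_rest _ lU lT) (users_rest _ l'U l'T).
  have := maxT _ goodU; have := cardsUI T1 T.
  have : #|T1 :&: T| = 0 by apply/eqP; rewrite cards_eq0 setI_eq0.
  by move: T10; rewrite -card_gt0; clear; lia.
(* Layers around [l0] that avoid the users of [T]; by [big_rest] each layer is larger than the
   neighborhood of the previous one. *)
pose fix G k : {set L} := if k is k'.+1 then rest (nbrs e (G k')) else [set l0].
have GT k l : l \in G k -> l \notin users T.
  by case: k => [|k] /=; [move=> /set1P ->|move=> /setDP[]].
have Gspread k : G k \subset spread k l0.
  elim: k => [|k IH] //=; apply/subsetP => l /setDP[/usersP[r rl rN] _].
  by apply/usersP; exists r => //; apply: (subsetP (nbrsS _ IH)).
have spread_mono k : nbrs e (spread k l0) \subset nbrs e (spread k.+1 l0).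
  apply: nbrsS; elim: k => [|k IH] /=.
    by apply/subsetP => l /set1P ->; have /set0Pn[r rl] := dem0; apply/usersP; exists r => //;
       apply/nbrsP; exists l0 => //; rewrite inE.
  apply/subsetP => l /usersP[r rl rN]; apply/usersP; exists r => //.
  exact: (subsetP (nbrsS _ IH)).
have spread_le j k : j <= k -> nbrs e (spread j l0) \subset nbrs e (spread k l0).
  move=> /subnK <-; elim: (k - j) => [|i IH] //.
  by rewrite addSn; apply: subset_trans IH (spread_mono _).
have grow k : k <= D * q -> D.+1 ^ k <= D ^ k * #|G k| /\ G k != set0.
  elim: k => [|k IH] le_k.
    by rewrite /= cards1; split=> //; apply/set0Pn; exists l0; rewrite inE.
  have [le1 Gk0] := IH (ltnW le_k).
  have Gdem l : l \in G k -> e l != set0.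
    by move=> /(subsetP (Gspread k)); apply: spread_dem.
  have := expand (G k) Gdem.
  have : #|nbrs e (G k)| < #|rest (nbrs e (G k))|.
    apply: big_rest.
    - by apply: subset_trans (spread_le _ _ (ltnW le_k)); apply: nbrsS.
    - have /set0Pn[l lG] := Gk0; have /set0Pn[r rl] := Gdem _ lG.
      by apply/set0Pn; exists r; apply/nbrsP; exists l.
    - apply/pred0P => r /=; apply/negP => /andP[/nbrsP[l /GT lT rl] rT].
      by case/negP: lT; apply/usersP; exists r.
  rewrite -/(G k.+1) => ltN exG; split; last by rewrite -card_gt0; apply: leq_ltn_trans ltN.
  rewrite !expnS; apply: (@leq_trans (D.+1 * (D ^ k * #|G k|))); first by rewrite leq_mul2l le1 orbT.
  rewrite mulnCA (mulnC D (D ^ k)) -mulnA leq_mul2l; apply/orP; right.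
  by apply: leq_trans exG _; rewrite leq_mul2l ltnW ?orbT.
(* After [D * q] layers, [(2 * D ^ D) ^ q <= D.+1 ^ (D * q) <= D ^ (D * q) * #|L|], so that
   [2 ^ q <= #|L|]. *)
have [big _] := grow _ (leqnn _).
have : (2 * D ^ D) ^ q <= D ^ (D * q) * #|L|.
  apply: (@leq_trans (D.+1 ^ (D * q))).
    by rewrite expnM; case: (q) => [|p] //; rewrite leq_exp2r // double_expn_succ.
  by apply: leq_trans big _; rewrite leq_mul2l max_card orbT.
rewrite expnMn -expnM mulnC leq_pmul2l ?expn_gt0 ?D0 //.
by rewrite leqNgt Lq.
Qed.

End Bipartite.


(* The structures of [saturating_structure] are shared without coordination:
   each vertex [l] uses the least structure [T] having [l] among its users.  If
   two vertices are given the same [r], then each of them is a user of the set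
   of the other one, so that both use the same structure. *)
Section LocalHall.
Variables (L R : finType) (D q : nat).
Implicit Types (B : graph (L + R)%type) (l : L) (r : R).

Definition right_nbrs B l : {set R} := [set r | inr r \in B (inl l)].

Local Notation structure_type := (L * {set R} * {ffun L -> option R})%type.

(** The left vertices of [spread (D * q)] are at distance at most [2 * (D * q)], and the set lies
    among their neighbors. *)
Definition structure_radius := ((D * q).*2).+1.

(** A structure consists of a center, a set and a matching of its users. The center, rather than
    [l], bounds the extent of the set, so [l] matters only through the requirement that it be a
    user; this makes candidates transferable between users. *)
Definition candidate B l (s : structure_type) :=
  [&& [forall r in s.1.2, inr r \in ball B structure_radius (inl s.1.1)],
      saturates (right_nbrs B) s.1.2 s.2 & l \in users (right_nbrs B) s.1.2].

Definition least_candidate B l :=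
  [pick s | candidate B l s &&
            [forall t, candidate B l t ==> (enum_rank s <= enum_rank t)]].

Definition hall_matching_def B (w : L + R) : option R :=
  if w is inl l then
    if least_candidate B l is Some s then s.2 l else None
  else None.

Definition hall_matching := locked hall_matching_def.

Lemma least_candidateP B l s : least_candidate B l = Some s ->
  candidate B l s /\ forall t, candidate B l t -> enum_rank s <= enum_rank t.
Proof.
rewrite /least_candidate; case: pickP => // s' /andP[cs /forallP min] [<-].
by split=> // t; apply: implyP (min t).
Qed.

Lemma least_candidate_exists B l s : candidate B l s ->
  exists s', least_candidate B l = Some s'.
Proof.
move=> cs; rewrite /least_candidate; case: pickP => [s' _|none]; first by exists s'.
have [t ct min] := @arg_minnP structure_type s (candidate B l) (fun t => enum_rank t) cs.
have := none t; rewrite ct /= => /negbT /forallPn[u]; rewrite negb_imply => /andP[cu].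
by rewrite min.
Qed.

Lemma hall_matching_edge B l r : hall_matching B (inl l) = Some r -> inr r \in B (inl l).
Proof.
rewrite /hall_matching -lock /hall_matching_def; case E: least_candidate => [s|] //.
have [/and3P[_ /saturatesP[sat _] /sat[r' [_ -> r'l]]] _] := least_candidateP E.
by case=> <-; rewrite inE in r'l.
Qed.

Lemma hall_matching_inj B l l' r :
  hall_matching B (inl l) = Some r -> hall_matching B (inl l') = Some r -> l = l'.
Proof.
move=> ml ml'; have rl := hall_matching_edge ml; have rl' := hall_matching_edge ml'.
move: ml ml'; rewrite /hall_matching -lock /hall_matching_def.
case E: least_candidate => [s|] //; case E': least_candidate => [s'|] // sl sl'.
have [cs mins] := least_candidateP E; have [cs' mins'] := least_candidateP E'.
have [balls sats ls] := and3P cs; have [balls' sats' ls'] := and3P cs'.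
have in_T l1 (t : structure_type) : saturates (right_nbrs B) t.1.2 t.2 -> l1 \in users (right_nbrs B) t.1.2 ->
    t.2 l1 = Some r -> r \in t.1.2.
  by move=> /saturatesP[sat _] /sat[r' [r'T -> _]] [<-].
have rT := in_T _ _ sats ls sl; have rT' := in_T _ _ sats' ls' sl'.
have c' : candidate B l' s.
  by apply/and3P; split=> //; apply/usersP; exists r => //; rewrite inE.
have c : candidate B l s'.
  by apply/and3P; split=> //; apply/usersP; exists r => //; rewrite inE.
have ss' : s = s'.
  by apply/enum_rank_inj/val_inj/eqP; rewrite eqn_leq mins ?mins'.
have [_ inj] := saturatesP _ _ _ sats.
by apply: inj; rewrite // ?ss' // sl' -ss' sl.
Qed.

Lemma spread_ball B k l0 l : symg B -> l \in spread (right_nbrs B) k l0 ->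
  inl l \in ball B k.*2 (inl l0).
Proof.
move=> symB; elim: k l => [|k IH] l /=; first by rewrite !inE => /eqP ->.
move=> /usersP[r rl /nbrsP[l1 /IH l1b rl1]]; rewrite !inE in rl rl1.
by apply: ball_step (ball_step l1b rl1) _; rewrite symB.
Qed.

Lemma hall_matching_total B l :
  symg B -> 0 < D -> #|L| < 2 ^ q ->
  (forall S : {set L}, (forall l, l \in S -> right_nbrs B l != set0) ->
    D.+1 * #|S| <= D * #|nbrs (right_nbrs B) S|) ->
  right_nbrs B l != set0 -> exists r, hall_matching B (inl l) = Some r.
Proof.
move=> symB D0 Lq expand dem.
have [T [f [TX lT satT]]] := saturating_structure D0 Lq dem expand.
have cl : candidate B l (l, T, f).
  apply/and3P; split=> //=; apply/forallP => r; apply/implyP => /(subsetP TX).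
  move=> /nbrsP[l' /(spread_ball symB) l'b rl']; rewrite inE in rl'.
  exact: ball_step l'b rl'.
have [s E] := least_candidate_exists cl.
have [/and3P[_ /saturatesP[sat _] /sat[r [_ sl _]]] _] := least_candidateP E.
by exists r; rewrite /hall_matching -lock /hall_matching_def E sl.
Qed.

(** From [l] one step leads into the set of a candidate, [structure_radius] steps to its center, as
    many to any other element of the set, and one more to the users of that element. *)
Lemma hall_matching_local :
  local (@symg (L + R)%type) (structure_radius.*2).+2 hall_matching.
Proof.
move=> B B' w symB symB' ag; case: w ag => [l|r] ag; last by rewrite /hall_matching -lock.
suff cE B1 B2 s : symg B1 -> symg B2 -> agree (structure_radius.*2).+2 B1 B2 (inl l) ->
    candidate B1 l s -> candidate B2 l s.
  have cE' : candidate B l =1 candidate B' l.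
    by move=> s; apply/idP/idP; apply: cE => //; apply: agree_sym.
  rewrite /hall_matching -lock /hall_matching_def /least_candidate.
  have -> : [pick s | candidate B l s &&
      [forall t, candidate B l t ==> (enum_rank s <= enum_rank t)]] =
      [pick s | candidate B' l s &&
      [forall t, candidate B' l t ==> (enum_rank s <= enum_rank t)]].
    by apply: eq_pick => s; rewrite /= cE'; under eq_forallb => t do rewrite cE'.
  by [].
rewrite /candidate; move: structure_radius => rho in ag *.
move=> {symB symB' ag B B'} symB symB' ag.
case: s => [[c T] f] /= /and3P[/forallP balls /saturatesP[sat inj] lT].
have [r0 r0l r0T] := usersP _ _ _ lT; rewrite inE in r0l.
have cb : inl c \in ball B1 rho.+1 (inl l).
  rewrite -addn1; apply: ball_trans (ball_nbr r0l) _.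
  by apply: ball_sym => //; apply: implyP (balls r0) r0T.
have Tb r : r \in T -> inr r \in ball B1 (rho.*2).+1 (inl l).
  by move=> rT; rewrite -addnn -addnS; apply: ball_trans cb _; apply: implyP (balls r) rT.
have Ub l' : l' \in users (right_nbrs B1) T -> inl l' \in ball B1 (rho.*2).+2 (inl l).
  case/usersP => r rl' /Tb rb; apply: ball_step rb _.
  by rewrite inE in rl'; rewrite symB.
have rowT r : r \in T -> B1 (inr r) = B2 (inr r).
  by move=> /Tb rb; apply: ag; apply: ball_leP rb.
have rowU l' : l' \in users (right_nbrs B1) T -> right_nbrs B1 l' = right_nbrs B2 l'.
  by move=> /Ub l'b; apply/setP => r; rewrite !inE ag.
have usersE : users (right_nbrs B1) T = users (right_nbrs B2) T.
  apply/setP => l'; apply/usersP/usersP => -[r rl' rT]; exists r => //;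
    by move: rl'; rewrite !inE symB symB' rowT.
apply/and3P; split.
- apply/forallP => r; apply/implyP => rT; rewrite -(@agree_ball_le _ rho rho B1 B2 (inl c)) //.
    by apply: implyP (balls r) rT.
  by apply: agree_sub cb; apply: agree_le ag; rewrite -addnn -addnS; apply: leqnSn.
- apply/saturatesP; rewrite -usersE; split=> // l' l'T.
  by have [r [rT fl' rl']] := sat l' l'T; exists r; rewrite -rowU.
- by rewrite -usersE.
Qed.

End LocalHall.


(** * Maximal matchings and ruling sets, by symmetry breaking along the bits of the keys *)

Definition is_matching (V : finType) (g : graph V) (p : V -> option V) :=
  forall u v, p u = Some v -> v \in g u /\ p v = Some u.

Section SymmetryBreaking.
Variables (V : finType) (m : nat) (key : V -> nat -> bool).
Hypothesis key_inj : forall u v, (forall b, b < m -> key u b = key v b) -> u = v.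
Implicit Types (g : graph V) (p : V -> option V) (u v w : V).

Definition proposal b g p u : option V :=
  if key u b && (p u == None)
  then [pick v in g u | (p v == None) && ~~ key v b] else None.

Definition acceptance b g p v : option V :=
  if ~~ key v b && (p v == None)
  then [pick u in g v | proposal b g p u == Some v] else None.

Definition proposal_round b g p w : option V :=
  if p w is Some u then Some u
  else if key w b then
    if proposal b g p w is Some v then
      if acceptance b g p v == Some w then Some v else None
    else None
  else acceptance b g p w.

(* The edges whose endpoints have different [b]-th bits form a bipartite graph
   with known sides: the vertices with bit 1 propose, those with bit 0 accept. *)
Fixpoint maximal_matching_upto d k g : V -> option V :=
  if k is k'.+1 then iter d (proposal_round k' g) (maximal_matching_upto d k' g)
  else fun=> None.

Definition maximal_matching := locked (fun d => maximal_matching_upto d m).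

Lemma proposalP b g p u v : proposal b g p u = Some v ->
  [/\ key u b, p u = None, v \in g u, p v = None & ~~ key v b].
Proof.
rewrite /proposal; case: ifP => // /andP[ku /eqP pu].
by case: pickP => // w /andP[wu /andP[/eqP pw kw]] [<-].
Qed.

Lemma acceptanceP b g p u v : acceptance b g p v = Some u ->
  u \in g v /\ proposal b g p u = Some v.
Proof.
rewrite /acceptance; case: ifP => // _.
by case: pickP => // w /andP[wv /eqP pw] [<-].
Qed.

Lemma proposal_round_matching b g p :
  symg g -> is_matching g p -> is_matching g (proposal_round b g p).
Proof.
move=> symg_g mp u v; rewrite /proposal_round.
case pu: (p u) => [w|]; first by case=> <-; have [wu ->] := mp _ _ pu.
case: ifPn => ku.
  case E: proposal => [w|] //; case: eqP => // acc [<-].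
  have [_ _ wu pw kw] := proposalP E.
  by rewrite pw (negPf kw).
move=> acc; have [vu prop] := acceptanceP acc.
have [kv pv _ _ _] := proposalP prop.
by rewrite pv kv prop acc eqxx.
Qed.

Lemma proposal_round_mono b g p u v :
  p u = Some v -> proposal_round b g p u = Some v.
Proof. by rewrite /proposal_round => ->. Qed.

Definition candidates b g p u := [set v in g u | (p v == None) && ~~ key v b].

Lemma candidates_round b g p u : candidates b g (proposal_round b g p) u \subset candidates b g p u.
Proof.
apply/subsetP => v; rewrite !inE => /and3P[-> + ->]; rewrite andbT /=.
by case pv: (p v) => [w|] //; rewrite (proposal_round_mono _ _ pv).
Qed.

(** The vertex to which [u] proposes accepts some proposal in this round, so even a rejected [u]
    loses that candidate. *)
Lemma candidates_decr b g p u : symg g ->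
  key u b -> proposal_round b g p u = None -> candidates b g p u != set0 ->
  #|candidates b g (proposal_round b g p) u| < #|candidates b g p u|.
Proof.
move=> symg_g ku ru /set0Pn[v0]; rewrite inE => v0P.
apply: proper_card; apply/properP; split; first exact: candidates_round.
have pu : p u = None by move: ru; rewrite /proposal_round; case: (p u).
have [v prop] : exists v, proposal b g p u = Some v.
  rewrite /proposal ku pu eqxx /=; case: pickP => [v _|/(_ v0)]; first by exists v.
  by rewrite v0P.
have [_ _ vu pv kv] := proposalP prop.
exists v; first by rewrite inE vu pv eqxx kv.
rewrite inE vu kv andbT /= /proposal_round pv (negPf kv).
rewrite /acceptance pv kv eqxx /=; case: pickP => // /(_ u).
by rewrite prop eqxx andbT -symg_g vu.
Qed.

Lemma iter_matching b g p k : symg g -> is_matching g p ->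
  is_matching g (iter k (proposal_round b g) p).
Proof. by move=> sg mp; elim: k => [|k IH] //=; apply: proposal_round_matching. Qed.

Lemma iter_mono b g p u v k :
  p u = Some v -> iter k (proposal_round b g) p u = Some v.
Proof. by move=> pu; elim: k => [|k IH] //=; apply: proposal_round_mono. Qed.

Lemma iter_candidates b g p u k d : symg g -> key u b -> #|g u| <= d ->
  iter k (proposal_round b g) p u = None ->
  #|candidates b g (iter k (proposal_round b g) p) u| <= d - k.
Proof.
move=> sg ku gd; elim: k => [|k IH] /= ru.
  by rewrite subn0; apply: leq_trans gd; apply/subset_leq_card/subsetP => v; rewrite inE => /andP[].
set q := iter _ _ _ in IH ru *.
have qu : q u = None by move: ru; rewrite /proposal_round; case: (q u).
have [c0|c0] := eqVneq (candidates b g q u) set0.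
  have := candidates_round b g q u; rewrite c0 subset0 => /eqP ->.
  by rewrite cards0.
have := candidates_decr sg ku ru c0; have := IH qu; clear; lia.
Qed.

Lemma maximal_matching_matching d g : symg g -> is_matching g (maximal_matching d g).
Proof.
by move=> sg; rewrite /maximal_matching -lock; elim: m => [|k IH] //=; apply: iter_matching.
Qed.

(** The keys of [u] and [v] differ in some bit [b]. If the endpoint with bit 1 is still unmatched
    after the [d] rounds of phase [b], it has run out of candidates, so the other endpoint is
    matched; later rounds undo nothing. *)
Lemma maximal_matchingP d g u v : symg g -> (forall u, #|g u| <= d) -> v \in g u -> u != v ->
  maximal_matching d g u != None \/ maximal_matching d g v != None.
Proof.
move=> sg gd vu neq_uv.
have [b lt_bm kuv] : exists2 b, b < m & key u b != key v b.
  have [/existsP[b kb]|none] := boolP [exists b : 'I_m, key u b != key v b].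
    by exists b.
  case/eqP: neq_uv; apply: key_inj => b lt_bm; apply/eqP/negPn.
  by have := forallP (etrans (esym (negb_exists _)) none) (Ordinal lt_bm).
wlog ku : u v vu neq_uv kuv / key u b.
  move=> th; case ku: (key u b); first by apply: th vu neq_uv kuv ku.
  have kv : key v b by move: kuv; rewrite ku; case: (key v b).
  apply/or_comm; apply: th kv; [by rewrite -sg|by rewrite eq_sym|by rewrite eq_sym].
have kv : ~~ key v b by case: (key v b) kuv; rewrite ku.
have maxb k : b < k -> maximal_matching_upto d k g u != None \/ maximal_matching_upto d k g v != None.
  elim: k => // k IH; rewrite ltnS leq_eqVlt => /orP[/eqP <-|lt_bk] /=.
    set p := maximal_matching_upto _ _ _.
    case ru: (iter _ _ _ u) => [w|]; [by left|right].
    have := iter_candidates sg ku (gd u) ru; rewrite subnn leqn0 cards_eq0 => /eqP/setP/(_ v).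
    by rewrite !inE vu kv andbT /= => ->.
  by case: (IH lt_bk) => H; [left|right]; move: H; case E: maximal_matching_upto => [w|] // _;
     rewrite (iter_mono _ _ _ E).
by rewrite /maximal_matching -lock; apply: maxb.
Qed.

Lemma proposal_ext b g g' p p' u : g u = g' u -> {in ball g 1 u, p =1 p'} ->
  proposal b g p u = proposal b g' p' u.
Proof.
move=> gu pp'; rewrite /proposal (pp' u) ?ball_refl // -gu; case: ifP => // _.
by apply: eq_pick => v /=; case: (boolP (v \in g u)) => //= vu; rewrite (pp' v) // ball_nbr.
Qed.

Lemma acceptance_ext b g g' p p' v : agree 1 g g' v -> {in ball g 2 v, p =1 p'} ->
  acceptance b g p v = acceptance b g' p' v.
Proof.
move=> gv pp'; rewrite /acceptance (pp' v) ?ball_refl // -gv ?ball_refl //; case: ifP => // _.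
apply: eq_pick => u /=; case: (boolP (u \in g v)) => //= uv.
rewrite (@proposal_ext b g g' p p') //; first by rewrite gv ?ball_nbr.
by move=> w wb; apply: pp'; apply: ball_trans (ball_nbr uv) wb.
Qed.

(** A proposer looks at the acceptance of a neighbor, which depends on the proposals of that
    vertex's neighbors, which depend on their neighbors in turn: three units per round. *)
Lemma proposal_round_ext b g g' p p' w : agree 2 g g' w -> {in ball g 3 w, p =1 p'} ->
  proposal_round b g p w = proposal_round b g' p' w.
Proof.
move=> gw pp'; rewrite /proposal_round (pp' w) ?ball_refl //; case: (p' w) => //.
have acc v : v \in ball g 1 w -> acceptance b g p v = acceptance b g' p' v.
  move=> vb; apply: acceptance_ext => [|u ub]; first exact: agree_sub vb.
  by apply: pp'; apply: ball_trans vb ub.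
rewrite -(@proposal_ext b g g' p p' w); first last.
- by move=> u ub; apply: pp'; apply: ball_leP ub.
- by rewrite gw ?ball_refl.
case: ifP => _; last by apply: acc; apply: ball_refl.
case E: proposal => [v|] //; rewrite acc // ball_nbr //.
by have [_ _] := proposalP E.
Qed.

Lemma maximal_matching_local cls d : local cls (m * (d * 3)) (maximal_matching d).
Proof.
rewrite /maximal_matching -lock; elim: m => [|k IH] //=; rewrite mulSn addnC.
suff iterL j : local cls (k * (d * 3) + j * 3)
    (fun g => iter j (proposal_round k g) (maximal_matching_upto d k g)) by [].
elim: j => [|j IHj]; first by rewrite addn0.
move=> g g' x cg cg' ag; rewrite 2!iterS.
rewrite mulSn addnCA addnC in ag.
apply: proposal_round_ext => [|y yb].
  by apply: agree_le ag; rewrite addnC.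
by apply: IHj => //; apply: agree_sub yb.
Qed.

(** Thinning bit by bit: a survivor with bit 1 drops out if a survivor with bit 0 is within distance
    [r]. Survivors at distance at most [r] then agree on every bit treated so far, and each dropout
    has a survivor within distance [r]; hence the separation [r] and the domination [m * r]. *)
Fixpoint ruling_upto r k g : pred V :=
  if k is k'.+1 then fun v => ruling_upto r k' g v &&
    (key v k' ==> [forall u in ball g r v, ruling_upto r k' g u ==> key u k'])
  else xpredT.

Definition ruling r := ruling_upto r m.

Lemma ruling_sep r g u v : symg g ->
  ruling r g u -> ruling r g v -> v \in ball g r u -> u = v.
Proof.
move=> sg; have sep k : ruling_upto r k g u -> ruling_upto r k g v -> v \in ball g r u ->
    forall b, b < k -> key u b = key v b.
  elim: k => [|k IH] //= /andP[ru ku] /andP[rv kv] vb b.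
  rewrite ltnS leq_eqVlt => /orP[/eqP ->|]; last exact: IH.
  have ub := ball_sym sg vb.
  case Eu: (key u k); case Ev: (key v k) => //.
    by move: ku; rewrite Eu => /forallP/(_ v); rewrite vb rv Ev.
  by move: kv; rewrite Ev => /forallP/(_ u); rewrite ub ru Eu.
by move=> ru rv vb; apply: key_inj => b lt_bm; apply: (sep m).
Qed.

Lemma ruling_dom r g v : exists2 z, ruling r g z & z \in ball g (m * r) v.
Proof.
rewrite /ruling; elim: m => [|k [z rz zb]] /=; first by exists v; rewrite ?inE.
have zb' : z \in ball g (k.+1 * r) v by apply: ball_leP zb; rewrite mulSn leq_addl.
have [kz|] := boolP (key z k ==> [forall u in ball g r z, ruling_upto r k g u ==> key u k]).
  by exists z => //; rewrite rz kz.
rewrite negb_imply => /andP[_ /forallPn[u]]; rewrite !negb_imply => /and3P[ub ru ku].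
exists u; first by rewrite ru (negPf ku).
by rewrite mulSn; apply: ball_trans zb ub.
Qed.

Lemma ruling_local cls r : local cls (m * r) (ruling r).
Proof.
rewrite /ruling; elim: m => [|k IH] //= g g' x cg cg' ag.
rewrite mulSn addnC in ag.
rewrite (IH _ _ _ cg cg') //; last by apply: agree_le ag; apply: leq_addr.
congr (_ && (_ ==> _)).
have le_r : r <= (k * r + r).+1 by rewrite leqW ?leq_addl.
have bE := agree_ball_le ag le_r.
apply: eq_forallb => u; rewrite -bE; case: (boolP (u \in ball g r x)) => //= ub.
by rewrite (IH _ _ _ cg cg') //; apply: agree_sub ag ub.
Qed.

End SymmetryBreaking.


(** * Orienting graphs of maximum degree two as directed paths and cycles *)

Section Orientation.
Variable V : finType.
Implicit Types (h : graph V) (o : rel V) (x y z u v : V).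

Definition orientation h o : Prop :=
  [/\ forall x y, o x y -> y \in h x,
      forall x y, y \in h x -> o x y (+) o y x,
      forall x y z, o x y -> o x z -> y = z &
      forall x y z, o x z -> o y z -> x = y].

Lemma orientation_rev h o : symg h -> orientation h o -> orientation h (fun x y => o y x).
Proof.
move=> sh [o1 o2 o3 o4]; split=> [x y|x y xy|x y z xy xz|x y z xz yz].
- by rewrite sh; apply: o1.
- by rewrite addbC; apply: o2.
- exact: o4 xy xz.
- exact: o3 xz yz.
Qed.

Lemma orientation_noncycle h o x y : symg h -> orientation h o -> o x y -> ~~ o y x.
Proof. by move=> _ [o1 o2 _ _] xy; have := o2 _ _ (o1 _ _ xy); rewrite xy. Qed.

(** A component has at most one source: as in-arcs and out-arcs are unique, an undirected walk from
    a source can be replaced by a directed one. *)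
Lemma orientation_source h o u v : symg h -> orientation h o ->
  (forall x, ~~ o x u) -> (forall x, ~~ o x v) ->
  connect (fun x y => y \in h x) u v -> u = v.
Proof.
move=> sh [o1 o2 o3 o4] inu inv cuv.
have reach x : connect (fun x y => y \in h x) u x -> connect o u x.
  case/connectP => p; elim/last_ind: p x => [|p y IH] x /=; first by move=> _ ->.
  rewrite rcons_path last_rcons => /andP[pth lasty] ->.
  have cz := IH _ pth erefl; set z := last u p in lasty cz.
  have := o2 _ _ lasty.
  case zy: (o z y) => /= => [_|yz].
    by apply: connect_trans cz (connect1 zy).
  case/connectP: cz => q; case/lastP: q => [|q w] /=.
    by move=> _ zu; rewrite zu (negPf (inu _)) in yz.
  rewrite rcons_path last_rcons => /andP[qth wz] zw.
  rewrite zw in yz; rewrite (o4 _ _ _ yz wz).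
  by apply/connectP; exists q.
have /connectP[q] := reach _ cuv; case/lastP: q => [|q w] /=; first by move=> _ ->.
by rewrite rcons_path last_rcons => /andP[_ wz] vw; rewrite -vw (negPf (inv _)) in wz.
Qed.

Definition del_edge h u v : graph V :=
  fun x => [set y in h x | ~~ ((x == u) && (y == v) || (x == v) && (y == u))].

Lemma del_edgeC h u v x : del_edge h u v x = del_edge h v u x.
Proof. by apply/setP => y; rewrite !inE orbC. Qed.

Lemma del_edge_sgraph h u v : sgraph h -> sgraph (del_edge h u v).
Proof.
move=> [sh ih]; split=> [x y|x]; last by rewrite inE (negPf (ih x)).
rewrite !inE sh; congr (_ && ~~ _).
by rewrite [X in _ || X]andbC orbC [X in _ || X]andbC.
Qed.

Lemma add_arc h o u v : sgraph h -> v \in h u -> orientation (del_edge h u v) o ->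
  (forall x, ~~ o u x) -> (forall x, ~~ o x v) ->
  orientation h (fun x y => o x y || (x == u) && (y == v)).
Proof.
move=> [sh ih] uv [o1 o2 o3 o4] outu inv.
have neq_uv : u != v by apply: contraTneq uv => <-; apply: ih.
split=> [x y|x y xy|x y z|x y z].
- by case/orP => [/o1|/andP[/eqP -> /eqP ->]] //; rewrite inE => /andP[].
- have := o2 x y; rewrite inE xy /=.
  have ouv : o u v = false by apply/negP => /o1; rewrite inE !eqxx andbF.
  have ovu : o v u = false by apply/negP => /o1; rewrite inE !eqxx orbT andbF.
  case E: ((x == u) && (y == v)).
    case/andP: E => /eqP -> /eqP -> _.
    by rewrite ouv ovu (eq_sym v) (negPf neq_uv).
  case E': ((x == v) && (y == u)) => /=.
    case/andP: E' => /eqP -> /eqP -> _.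
    by rewrite ouv ovu !eqxx.
  by move=> /(_ isT); rewrite [(y == u) && _]andbC E' !orbF.
- case/orP => [xy|/andP[/eqP -> /eqP ->]]; case/orP => [xz|/andP[/eqP E /eqP ->]] //.
  + exact: o3 xy xz.
  + by rewrite E (negPf (outu _)) in xy.
  + by rewrite (negPf (outu _)) in xz.
- case/orP => [xy|/andP[/eqP -> /eqP ->]]; case/orP => [xz|/andP[/eqP E /eqP E']] //.
  + exact: o4 xy xz.
  + by rewrite E' (negPf (inv _)) in xy.
  + by rewrite (negPf (inv _)) in xz.
Qed.

Lemma flip_component h o u : symg h -> orientation h o ->
  orientation h (fun x y => if connect (fun x y => y \in h x) u x then o y x else o x y).
Proof.
move=> sh [o1 o2 o3 o4]; set c := connect _.
have cE x y : y \in h x -> c u x = c u y.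
  by move=> xy; apply/idP/idP => /connect_trans; apply; apply: connect1; rewrite // -sh.
split=> [x y|x y xy|x y z|x y z].
- by case: ifP => _ /o1; rewrite // sh.
- by rewrite -(cE _ _ xy); case: ifP => _; rewrite ?(addbC (o y x)); apply: o2.
- by case: ifP => _ xy xz; [apply: o4 xy xz|apply: o3 xy xz].
- move=> H1 H2.
  have z1 : c u x = c u z by apply: cE; move: H1; case: ifP => _ /o1; rewrite // sh.
  have z2 : c u y = c u z by apply: cE; move: H2; case: ifP => _ /o1; rewrite // sh.
  move: H1 H2; rewrite z1 z2; case: ifP => _ xz yz; [exact: o3 xz yz|exact: o4 xz yz].
Qed.

(** Induction on the edges. After the deletion of an edge between [u] and [v], both have at most one
    arc. If both arcs are outgoing or both incoming, the component of [u] is reversed first; it does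
    not contain [v], since it would have two sources or two sinks. The edge then fits as an arc in
    one of the two directions. *)
Lemma orientation_exists h : sgraph h -> (forall x, #|h x| <= 2) -> exists o, orientation h o.
Proof.
have [k] := ubnP (\sum_x #|h x|); elim: k h => // k IH h le_k gh d2.
have [sh ih] := gh.
have [/existsP[u /existsP[v uv]]|] := boolP [exists u, exists v, v \in h u]; last first.
  rewrite negb_exists => /forallP none; exists (fun _ _ => false); split=> // x y xy.
  by have := none x; rewrite negb_exists => /forallP/(_ y); rewrite xy.
have neq_uv : u != v by apply: contraTneq uv => <-; apply: ih.
set h' := del_edge h u v.
have gh' : sgraph h' := del_edge_sgraph u v gh.
have [sh' ih'] := gh'.
have subh' x : h' x \subset h x by apply/subsetP => y; rewrite inE => /andP[].
have h'u : h' u = h u :\ v.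
  by apply/setP => y; rewrite !inE eqxx (negPf neq_uv) orbF /= andbC.
have h'v : h' v = h v :\ u.
  by apply/setP => y; rewrite !inE eqxx (eq_sym v) (negPf neq_uv) /= andbC.
have du : #|h' u| <= 1 by have := d2 u; rewrite h'u (cardsD1 v) uv.
have dv : #|h' v| <= 1 by have := d2 v; rewrite h'v (cardsD1 u) -sh uv.
have [|x|o oo] := IH h' _ gh'.
- rewrite ltnS in le_k; apply: leq_trans le_k; rewrite (bigD1 u) //= [X in _ < X](bigD1 u) //=.
  rewrite h'u [X in _ < X + _](cardsD1 v) uv add1n addSn ltnS leq_add2l.
  by apply: leq_sum => x _; apply: subset_leq_card.
- by apply: leq_trans (d2 x); apply: subset_leq_card.
have [o1 o2 o3 o4] := oo.
have one x y z : #|h' x| <= 1 -> o x y -> ~~ o z x.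
  move=> dx xy; apply/negP => zx.
  have /card_le1_eqP/(_ y z) := dx; rewrite o1 // sh' o1 // => /(_ isT isT) yz.
  by rewrite -yz in xy; have := orientation_noncycle sh' oo xy; rewrite zx.
have oo_vu : orientation (del_edge h v u) o.
  by split=> // x y; rewrite -del_edgeC; [apply: o1|apply: o2].
have vu : u \in h v by rewrite -sh.
have [/existsP[y uy]|outu] := boolP [exists y, o u y]; last first.
  have {}outu y : ~~ o u y by move: outu; rewrite negb_exists => /forallP.
  have [/existsP[y yv]|inv] := boolP [exists y, o y v]; last first.
    exists (fun x y => o x y || (x == u) && (y == v)); apply: add_arc => // x.
    by move: inv; rewrite negb_exists => /forallP.
  have outv x : ~~ o v x by apply/negP => vx; have := one _ _ y dv vx; rewrite yv.
  have [/existsP[w wu]|inu] := boolP [exists y, o y u]; last first.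
    exists (fun x y => o x y || (x == v) && (y == u)); apply: add_arc => // x.
    by move: inu; rewrite negb_exists => /forallP.
  pose f x y := if connect (fun x y => y \in h' x) u x then o y x else o x y.
  have of' : orientation (del_edge h v u) f.
    have [f1 f2 f3 f4] := flip_component u sh' oo.
    by split=> // x z; rewrite -del_edgeC; [apply: f1|apply: f2].
  have cuv : connect (fun x y => y \in h' x) u v = false.
    apply/negP => c; case/eqP: neq_uv.
    exact: orientation_source (orientation_rev sh' oo) outu outv c.
  exists (fun x y => f x y || (x == v) && (y == u)); apply: add_arc => // x.
    by rewrite /f cuv.
  rewrite /f; case: ifP => cx; first exact: outu.
  by apply/negP => xu; move: cx; rewrite connect1 // sh' o1.
have inu x : ~~ o x u by apply: one uy.
have [/existsP[w vw]|outv] := boolP [exists y, o v y]; last first.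
  exists (fun x y => o x y || (x == v) && (y == u)); apply: add_arc => // x.
  by move: outv; rewrite negb_exists => /forallP.
have inv x : ~~ o x v by apply: one vw.
pose f x y := if connect (fun x y => y \in h' x) u x then o y x else o x y.
have of' : orientation h' f by apply: flip_component.
have cuv : connect (fun x y => y \in h' x) u v = false.
  by apply/negP => c; case/eqP: neq_uv; apply: orientation_source oo inu inv c.
exists (fun x y => f x y || (x == u) && (y == v)); apply: add_arc => // x.
  by rewrite /f connect0.
rewrite /f; case: ifP => cx; last exact: inv.
by apply/negP => vx; move: cuv; rewrite (connect_trans cx) // connect1 // sh' o1.
Qed.

End Orientation.


(** * Coloring the edges of bounded paths and even cycles with two colors *)

Section TwoColoring.
Variable V : finType.
Implicit Types (h : graph V) (kappa : V -> bool) (x y z : V).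

Definition orientationb (h : {ffun V -> {set V}}) (o : {ffun V * V -> bool}) :=
  [&& [forall x, forall y, o (x, y) ==> (y \in h x)],
      [forall x, forall y, (y \in h x) ==> (o (x, y) (+) o (y, x))],
      [forall x, forall y, forall z, o (x, y) ==> o (x, z) ==> (y == z)] &
      [forall x, forall y, forall z, o (x, z) ==> o (y, z) ==> (x == y)]].

Lemma orientationbP (h : {ffun V -> {set V}}) (o : {ffun V * V -> bool}) :
  reflect (orientation h (fun x y => o (x, y))) (orientationb h o).
Proof.
apply: (iffP and4P) => -[o1 o2 o3 o4]; split.
- by move=> x y; apply: implyP (forallP (forallP o1 x) y).
- by move=> x y; apply: implyP (forallP (forallP o2 x) y).
- by move=> x y z xy xz; have := forallP (forallP (forallP o3 x) y) z; rewrite xy xz => /eqP.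
- by move=> x y z xy xz; have := forallP (forallP (forallP o4 x) y) z; rewrite xy xz => /eqP.
- by apply/forallP => x; apply/forallP => y; apply/implyP/o1.
- by apply/forallP => x; apply/forallP => y; apply/implyP/o2.
- apply/forallP => x; apply/forallP => y; apply/forallP => z.
  by apply/implyP => xy; apply/implyP => xz; apply/eqP; apply: o3 xy xz.
- apply/forallP => x; apply/forallP => y; apply/forallP => z.
  by apply/implyP => xy; apply/implyP => xz; apply/eqP; apply: o4 xy xz.
Qed.

Definition restrict h (K : {set V}) : {ffun V -> {set V}} :=
  [ffun x => if x \in K then h x else set0].

(** The choice depends only on the restricted graph, which [restrict] stores as a finite function.
    Hence all vertices of a component of radius at most [B] make the same choice, and so do graphs
    that agree there. *)
Definition component_orientation B h x : {ffun V * V -> bool} :=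
  odflt [ffun=> false] [pick o | orientationb (restrict h (ball h B x)) o].

(* An inner vertex [b] of a path has color [kappa b] on its incoming arc and
   color [~~ kappa b] on its outgoing arc; this is consistent along an arc
   between two inner vertices when [kappa] alternates. *)
Definition arc_color h kappa a b :=
  if #|h b| == 2 then kappa b else if #|h a| == 2 then ~~ kappa a else true.

Definition edge_color B h kappa x y :=
  if component_orientation B h x (x, y) then arc_color h kappa x y
  else arc_color h kappa y x.

Definition bounded_components B h :=
  forall x y, connect (fun x y => y \in h x) x y -> y \in ball h B x.

Lemma ball_connect h t x y : y \in ball h t x -> connect (fun x y => y \in h x) x y.
Proof.
elim: t y => [|t IH] y; first by rewrite inE => /eqP ->.
case/ballSP => z /IH c [-> //|zy]; exact: connect_trans c (connect1 zy).
Qed.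

Lemma component_orientationP B h x : sgraph h -> (forall x, #|h x| <= 2) ->
  bounded_components B h ->
  orientation (restrict h (ball h B x)) (fun a b => component_orientation B h x (a, b)).
Proof.
move=> [sh ih] d2 bh; set K := ball h B x.
have KE a : (a \in K) = connect (fun x y => y \in h x) x a.
  by apply/idP/idP => [/ball_connect|/bh].
have cK a b : b \in h a -> a \in K -> b \in K.
  by move=> ab; rewrite !KE => c; apply: connect_trans c (connect1 ab).
have sr : sgraph (restrict h K).
  split=> [a b|a]; last by rewrite ffunE; case: ifP; rewrite ?inE // (negPf (ih a)).
  rewrite !ffunE; case: ifPn => aK; case: ifPn => bK; rewrite ?inE //.
    by apply/negP => /cK/(_ aK); rewrite (negPf bK).
  by apply/esym/negP => /cK/(_ bK); rewrite (negPf aK).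
have rd a : #|restrict h K a| <= 2 by rewrite ffunE; case: ifP; rewrite ?cards0.
have [o oo] := orientation_exists sr rd.
pose o' := [ffun p : V * V => o p.1 p.2].
rewrite /component_orientation -/K; case: pickP => [o1 /orientationbP //|/(_ o')].
move=> /negP; case; apply/orientationbP.
have oE a b : o' (a, b) = o a b by rewrite ffunE.
by have [o1 o2 o3 o4] := oo; split=> [a b|a b|a b c|a b c]; rewrite !oE;
   [apply: o1|apply: o2|apply: o3|apply: o4].
Qed.

Section Proper.
Variables (B : nat) (h : graph V) (kappa : V -> bool).
Hypotheses (gh : sgraph h) (d2 : forall x, #|h x| <= 2) (bh : bounded_components B h).
Hypothesis alternate :
  forall a b, b \in h a -> #|h a| = 2 -> #|h b| = 2 -> kappa a != kappa b.

Lemma component_eq x y : y \in h x -> ball h B x = ball h B y.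
Proof.
move=> xy; have [sh _] := gh; apply/setP => z; apply/idP/idP => /ball_connect c; apply: bh.
  by apply: connect_trans (connect1 _) c; rewrite /= -sh.
exact: connect_trans (connect1 xy) c.
Qed.

Lemma component_orientation_eq x y : y \in h x ->
  component_orientation B h x = component_orientation B h y.
Proof. by move=> xy; rewrite /component_orientation (component_eq xy). Qed.

Lemma edge_color_sym x y : y \in h x -> edge_color B h kappa x y = edge_color B h kappa y x.
Proof.
move=> xy; rewrite /edge_color -(component_orientation_eq xy).
have [_ o2 _ _] := component_orientationP x gh d2 bh.
have := o2 x y; rewrite ffunE ball_refl => /(_ xy).
by case: (component_orientation B h x (x, y)); case: (component_orientation B h x (y, x)).
Qed.

Lemma edge_color_proper x y z : y \in h x -> z \in h x -> y != z ->
  edge_color B h kappa x y != edge_color B h kappa x z.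
Proof.
move=> xy xz neq_yz; have [sh ih] := gh.
have [_ o2 o3 o4] := component_orientationP x gh d2 bh.
have dx : #|h x| = 2.
  by apply/eqP; rewrite eqn_leq d2; apply/card_gt1P; exists y, z.
have oxy := o2 x y; have oxz := o2 x z; rewrite ffunE ball_refl in oxy oxz.
move: (oxy xy) (oxz xz) => {}oxy {}oxz.
have inc w : w \in h x -> arc_color h kappa w x = kappa x.
  by move=> xw; rewrite /arc_color dx eqxx.
(* If the head [w] of an outgoing arc has degree two, its own bit decides, and by alternation this
   is [~~ kappa x]; otherwise [x] decides itself. *)
have outc w : w \in h x -> arc_color h kappa x w = ~~ kappa x.
  move=> xw; rewrite /arc_color dx eqxx; case: eqP => // dw.
  by have := alternate xw dx dw; case: (kappa x); case: (kappa w).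
rewrite /edge_color !inc // !outc //.
case Ey: (component_orientation B h x (x, y)); case Ez: (component_orientation B h x (x, z)).
- by case/eqP: neq_yz; apply: o3 Ey Ez.
- by case: (kappa x).
- by case: (kappa x).
- rewrite Ey in oxy; rewrite Ez in oxz.
  by case/eqP: neq_yz; apply: o4 oxy oxz.
Qed.

End Proper.

Lemma edge_color_ext B h h' kappa kappa' x y :
  bounded_components B h -> y \in h x ->
  agree B h h' x -> {in ball h B x, kappa =1 kappa'} ->
  edge_color B h kappa x y = edge_color B h' kappa' x y.
Proof.
move=> bh xy ag kk'.
have yb : y \in ball h B x by apply/bh/connect1.
have bE := agree_ball_le ag (leqnSn _).
rewrite /edge_color /component_orientation -bE.
have <- : restrict h (ball h B x) = restrict h' (ball h B x).
  by apply/ffunP => z; rewrite !ffunE; case: ifP => // zb; apply: ag.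
by rewrite /arc_color -!ag ?kk' ?ball_refl.
Qed.

End TwoColoring.


(** * The system of paths and cycles built from two maximal matchings and a Hall matching *)

Definition bounded_degree (V : finType) (d : nat) (g : graph V) : Prop :=
  sgraph g /\ forall v, #|g v| <= d.

Definition induced (V : finType) (h : graph V) (S : pred V) : graph V :=
  fun v => [set u in h v | S v && S u].

Lemma induced_symg (V : finType) (h : graph V) (S : pred V) : symg h -> symg (induced h S).
Proof. by move=> sh x y; rewrite !inE sh; congr (_ && _); apply: andbC. Qed.

Lemma induced_sub (V : finType) (h : graph V) (S : pred V) : subgraph (induced h S) h.
Proof. by move=> x; apply/subsetP => y; rewrite inE => /andP[]. Qed.

Lemma induced_local (V : finType) (cls : graph V -> Prop) s (h : graph V -> graph V)
    (S : graph V -> pred V) :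
  (forall g, cls g -> subgraph (h g) g) -> local cls s h -> local cls s S ->
  local cls s.+1 (fun g => induced (h g) (S g)).
Proof.
move=> sub lh lS g g' x cg cg' ag; apply/setP => y; rewrite !inE.
have ag0 : agree s g g' x by apply: agree_le ag.
rewrite -(lh _ _ _ cg cg' ag0) -(lS _ _ _ cg cg' ag0).
case: (boolP (y \in h g x)) => //= xy; congr (_ && _).
rewrite -addn1 in ag; apply: (local_near lS cg cg' ag).
by apply/ball_nbr/(subsetP (sub _ cg x)).
Qed.

Section PathSystem.
Variables (V : finType) (m : nat) (key : V -> nat -> bool).
Hypothesis key_inj : forall u v, (forall b, b < m -> key u b = key v b) -> u = v.
Hypothesis card_V : #|V| <= 2 ^ m.
Variable d : nat.
Hypothesis d_gt1 : 1 < d.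
Implicit Types (g h : graph V) (S : pred V) (u v : V).

Local Notation cls := (@bounded_degree V d).

Definition matching_in (h : graph V) (S : pred V) :=
  maximal_matching m key d (induced h S).

Lemma matching_inP h S : symg h -> is_matching h (matching_in h S).
Proof.
move=> sh u v /(maximal_matching_matching (induced_symg _ sh)) [].
by rewrite inE => /andP[].
Qed.

Lemma matching_in_mem h S u v : symg h -> matching_in h S u = Some v -> S u /\ S v.
Proof.
move=> sh /(maximal_matching_matching (induced_symg _ sh)) [].
by rewrite inE => /and3P[].
Qed.

Lemma matching_in_max h S u v : sgraph h -> (forall v, #|h v| <= d) ->
  S u -> S v -> v \in h u -> matching_in h S u != None \/ matching_in h S v != None.
Proof.
move=> [sh ih] hd Su Sv uv; apply: (maximal_matchingP key_inj).
- exact: induced_symg.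
- by move=> w; apply: leq_trans (hd w); apply/subset_leq_card/induced_sub.
- by rewrite inE uv Su.
- by apply: contraTneq uv => <-; apply: ih.
Qed.

Lemma matching_in_local s (h : graph V -> graph V) (S : graph V -> pred V) :
  (forall g, cls g -> subgraph (h g) g) -> local cls s h -> local cls s S ->
  local cls (s.+1 + m * (d * 3)) (fun g => matching_in (h g) (S g)).
Proof.
move=> sub lh lS; apply: (@local_sub _ cls (fun _ => True) s.+1 _ _
  (fun g => induced (h g) (S g)) (maximal_matching m key d)) => //.
- move=> g cg x; apply: subset_trans (sub g cg x); exact: induced_sub.
- exact: induced_local.
- exact: maximal_matching_local.
Qed.

Definition full_degree g : pred V := fun v => #|g v| == d.
Definition first_matching g := matching_in g (full_degree g).
Definition exposed g : pred V := fun v => full_degree g v && (first_matching g v == None).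

(** Both sides are copies of the vertex set. Exposed vertices are independent, so a right vertex
    with an edge is never exposed itself. *)
Definition exposed_bip g : graph (V + V)%type := fun w =>
  match w with
  | inl u => [set w | if w is inr r then exposed g u && (r \in g u) else false]
  | inr r => [set w | if w is inl u then exposed g u && (r \in g u) else false]
  end.

(** The expansion factor is [d / (d - 1)], hence [D = d.-1]; the exponent [m.+1] makes [2 ^ m] a
    strict underestimate, as [hall_matching_total] requires. *)
Definition cover_edge g u : option V := hall_matching d.-1 m.+1 (exposed_bip g) (inl u).

Definition cover g : graph V := fun v =>
  [set u in g v | [|| first_matching g v == Some u, cover_edge g v == Some u |
                      cover_edge g u == Some v]].

Definition residue1 g : graph V := fun v => g v :\: cover g v.
Definition heavy g : pred V := fun v => #|residue1 g v| == d.-1.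
Definition second_matching g := matching_in (residue1 g) (heavy g).

Definition paths g : graph V := fun v =>
  [set u in g v | (u \in cover g v) || (second_matching g v == Some u)].

Definition residue2 g : graph V := fun v => g v :\: paths g v.
Definition needy g : pred V := fun v => #|residue2 g v| == d.-1.

(** The summands are the radius for a row of [exposed_bip], the radius of its Hall matching, and one
    unit for reading [cover_edge] at the neighbors. *)
Definition cover_radius :=
  (m * (d * 3)).+1.+1 + (structure_radius d.-1 m.+1).*2.+2.+1.
Definition needy_radius := cover_radius.+1 + m * (d * 3).

Lemma exposed_bip_symg g : symg (exposed_bip g).
Proof. by move=> [u|r] [u'|r']; rewrite !inE. Qed.

Lemma full_degree_local : local cls 0 full_degree.
Proof. by move=> g g' x _ _ ag; rewrite /full_degree ag ?inE. Qed.

Lemma first_matching_local : local cls (m * (d * 3)).+1 first_matching.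
Proof.
apply: (@matching_in_local 0 (fun g => g) full_degree) => [g _ x||] //.
  exact: local_row.
exact: full_degree_local.
Qed.

Lemma exposed_local : local cls (m * (d * 3)).+1 exposed.
Proof.
move=> g g' x cg cg' ag; rewrite /exposed (first_matching_local cg cg' ag).
by rewrite (full_degree_local cg cg') //; apply: agree_le ag.
Qed.

Lemma cover_edge_local : local cls cover_radius.-1 cover_edge.
Proof.
move=> g g' x cg cg' ag.
apply: (@local_host V _ (fun w : V + V => match w with inl v => v | inr v => v end)
  exposed_bip cls (@symg _) (m * (d * 3)).+2 1 _ _ _ g g' (inl x)
  _ _ _ (@hall_matching_local V V d.-1 m.+1)) => //.
- by move=> g1 _; apply: exposed_bip_symg.
- move=> g1 g2 w cg1 cg2 ag1; have [[sg1 _] _] := cg1; have [[sg2 _] _] := cg2.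
  case: w ag1 => v ag1; apply/setP => -[u|u]; rewrite ?inE //.
    rewrite (exposed_local cg1 cg2) ?ag1 ?ball_refl //; exact: agree_le ag1.
  rewrite sg1 sg2 ag1 ?ball_refl //; case: (boolP (u \in g2 v)); rewrite ?andbF // => uv.
  rewrite !andbT; rewrite -addn1 in ag1; apply: (local_near exposed_local cg1 cg2 ag1).
  by apply: ball_nbr; rewrite ag1 ?ball_refl.
- move=> g1 [v|v] [u|u] [[sg1 _] _]; rewrite !inE //= => /andP[_ uv]; apply: ball_nbr => //.
  by rewrite sg1.
- by rewrite mul1n; apply: agree_le ag; rewrite /cover_radius [X in _ <= X.-1]addnS.
Qed.

Lemma cover_local : local cls cover_radius cover.
Proof.
move=> g g' x cg cg' ag.
have ag1 : agree (cover_radius.-1 + 1) g g' x by apply: agree_le ag; rewrite addn1.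
have ag2 : agree cover_radius.-1 g g' x by apply: agree_le ag; apply: leq_pred.
have gx : g x = g' x := ag x (ball_refl _ _ _).
apply/setP => u; rewrite [LHS]inE [RHS]inE -gx; case: (boolP (u \in g x)) => //= ux.
rewrite (first_matching_local cg cg'); last first.
  by apply: agree_le ag; apply: leq_trans (leqnSn _) (leq_addr _ _).
rewrite (cover_edge_local cg cg' ag2) (local_near cover_edge_local cg cg' ag1) //.
exact: ball_nbr.
Qed.

Lemma residue1_local : local cls cover_radius residue1.
Proof.
move=> g g' x cg cg' ag; have gx : g x = g' x := ag x (ball_refl _ _ _).
by rewrite /residue1 (cover_local cg cg' ag) gx.
Qed.

Lemma heavy_local : local cls cover_radius heavy.
Proof. by move=> g g' x cg cg' ag; rewrite /heavy (residue1_local cg cg' ag). Qed.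

Lemma second_matching_local : local cls needy_radius second_matching.
Proof.
apply: matching_in_local => [g _ x||]; first exact: subsetDl.
  exact: residue1_local.
exact: heavy_local.
Qed.

Lemma cover_le_needy_radius : cover_radius <= needy_radius.
Proof. exact: leq_trans (leqnSn _) (leq_addr _ _). Qed.

Lemma paths_local : local cls needy_radius paths.
Proof.
move=> g g' x cg cg' ag; have gx : g x = g' x := ag x (ball_refl _ _ _).
have cx := cover_local cg cg' (agree_le cover_le_needy_radius ag).
by rewrite /paths (second_matching_local cg cg' ag) gx cx.
Qed.

Lemma residue2_local : local cls needy_radius residue2.
Proof.
move=> g g' x cg cg' ag; have gx : g x = g' x := ag x (ball_refl _ _ _).
by rewrite /residue2 (paths_local cg cg' ag) gx.
Qed.

Lemma needy_local : local cls needy_radius needy.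
Proof. by move=> g g' x cg cg' ag; rewrite /needy (residue2_local cg cg' ag). Qed.

Section Correct.
Variable g : graph V.
Hypothesis cg : cls g.
Let sg : symg g. Proof. by have [[]] := cg. Qed.
Let ig : forall v, v \notin g v. Proof. by have [[]] := cg. Qed.
Let dg : forall v, #|g v| <= d. Proof. by have [] := cg. Qed.

Lemma exposed_indep u v : exposed g u -> exposed g v -> v \notin g u.
Proof.
move=> /andP[fu /eqP mu] /andP[fv /eqP mv]; apply/negP => uv.
have [|] := matching_in_max (proj1 cg) dg fu fv uv.
  by rewrite -/(first_matching g) mu.
by rewrite -/(first_matching g) mv.
Qed.

Lemma cover_edgeP u r : cover_edge g u = Some r -> exposed g u /\ r \in g u.
Proof. by move=> /hall_matching_edge; rewrite inE => /andP[]. Qed.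

Lemma cover_edge_inj u v r : cover_edge g u = Some r -> cover_edge g v = Some r -> u = v.
Proof. exact: hall_matching_inj. Qed.

(** With unit weights an exposed vertex emits [d]. A right vertex receives at most [d - 1]: either
    its degree is below [d], or it has full degree without being exposed, so that its partner in the
    first matching is a neighbor that is not exposed. *)
Lemma cover_edge_total u : exposed g u -> exists r, cover_edge g u = Some r.
Proof.
move=> eu; have nbrsE l : right_nbrs (exposed_bip g) l = if exposed g l then g l else set0.
  by apply/setP => r; rewrite !inE; case: (exposed g l); rewrite ?inE.
apply: hall_matching_total; first exact: exposed_bip_symg.
- by rewrite -subn1 subn_gt0.
- by apply: leq_ltn_trans card_V _; rewrite ltn_exp2l.
- move=> S; apply: (weight_expand (w := fun l r => (exposed g l && (r \in g l) : nat))).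
  + by move=> l r; rewrite nbrsE lt0b => /andP[->].
  + move=> l; rewrite nbrsE; case: ifPn; rewrite ?eqxx // => el _.
    have -> : \sum_r ((true && (r \in g l)) : nat) = #|g l|.
      by rewrite -sum1_card [RHS]big_mkcond /=; apply: eq_bigr => r _; case: (r \in g l).
    by have /andP[/eqP -> _] := el; rewrite ltn_predL ltnW.
  + move=> r; have -> : \sum_l (exposed g l && (r \in g l) : nat) =
        #|[set l | exposed g l && (r \in g l)]|.
      rewrite -sum1_card [RHS]big_mkcond /=; apply: eq_bigr => l _.
      by rewrite inE; case: (_ && _).
    set A := [set l | _].
    have [-> |/set0Pn[l0]] := eqVneq A set0; first by rewrite cards0.
    rewrite inE => /andP[el0 rl0].
    have er : ~~ exposed g r by apply: contraL rl0; apply: exposed_indep.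
    have Ar : A \subset g r by apply/subsetP => l; rewrite inE -sg => /andP[].
    have [fr|fr] := boolP (full_degree g r); last first.
      rewrite -ltnS prednK ?(ltnW d_gt1) //; apply: leq_ltn_trans (subset_leq_card Ar) _.
      by rewrite ltn_neqAle dg andbT.
    move: er; rewrite /exposed fr /=; case E: first_matching => [s|] // _.
    have [rs Es] := matching_inP sg E.
    have -> : d.-1 = #|g r :\ s|.
      by have := cardsD1 s (g r); rewrite rs (eqP fr) add1n => ->.
    apply: subset_leq_card; apply/subsetD1P; split=> //.
    by rewrite inE /exposed [first_matching _ _]Es andbF.
- rewrite nbrsE eu; have /andP[/eqP du _] := eu.
  by rewrite -card_gt0 du ltnW.
Qed.

Lemma cover_symg : symg (cover g).
Proof.
move=> x y; rewrite !inE sg; congr (_ && _).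
rewrite [X in _ || X]orbC; congr (_ || _).
apply/eqP/eqP => /(matching_inP sg) [] //.
Qed.

Lemma cover_sub : subgraph (cover g) g.
Proof. by move=> x; apply/subsetP => y; rewrite inE => /andP[]. Qed.

Lemma cover_nonexposed v : ~~ exposed g v -> cover_edge g v = None.
Proof.
by move=> nv; case E: cover_edge => [r|] //; have [ev _] := cover_edgeP E; rewrite ev in nv.
Qed.

(** An exposed vertex is no image of [cover_edge] and keeps only its own cover edge; any other
    vertex has at most one edge of the first matching and one incoming cover edge. *)
Lemma card_cover v : #|cover g v| <= 2 /\ (exposed g v -> #|cover g v| <= 1).
Proof.
have le1 : #|[set u | first_matching g v == Some u]| <= 1.
  by apply/card_le1_eqP => x y; rewrite !inE => /eqP -> /eqP[].
have le2 : #|[set u | cover_edge g u == Some v]| <= 1.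
  by apply/card_le1_eqP => x y; rewrite !inE => /eqP Ex /eqP Ey; apply: cover_edge_inj Ey Ex.
have le3 : #|[set u | cover_edge g v == Some u]| <= 1.
  by apply/card_le1_eqP => x y; rewrite !inE => /eqP -> /eqP[].
have exp1 : exposed g v -> #|cover g v| <= 1.
  move=> ev; apply: leq_trans le3; apply/subset_leq_card/subsetP => u; rewrite !inE.
  have /andP[_ /eqP ->] := ev; case/andP => _ /= /orP[|/eqP /cover_edgeP[eu uv]] //.
  by rewrite (negPf (exposed_indep eu ev)) in uv.
split=> //; have [/exp1 /leq_trans -> //|nv] := boolP (exposed g v).
apply: leq_trans (leq_add le1 le2); apply: leq_trans (leq_card_setU _ _).
apply/subset_leq_card/subsetP => u; rewrite !inE (cover_nonexposed nv) /=.
by case/andP.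
Qed.

Lemma cover_full v : full_degree g v -> 0 < #|cover g v|.
Proof.
move=> fv; apply/card_gt0P; have [ev|] := boolP (exposed g v).
  have [r E] := cover_edge_total ev; have [_ vr] := cover_edgeP E.
  by exists r; rewrite inE vr E eqxx orbT.
rewrite /exposed fv /=; case E: first_matching => [s|] // _.
by have [vs _] := matching_inP sg E; exists s; rewrite inE vs E eqxx.
Qed.

Lemma card_residue1 v : #|residue1 g v| = #|g v| - #|cover g v|.
Proof. by rewrite cardsD (setIidPr (cover_sub v)). Qed.

Lemma residue1_le v : #|residue1 g v| <= d.-1.
Proof.
rewrite card_residue1; have [fv|fv] := boolP (full_degree g v).
  have := cover_full fv; rewrite (eqP fv); clear; lia.
have : #|g v| < d by rewrite ltn_neqAle dg andbT.
clear; lia.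
Qed.

Lemma residue1_sgraph : sgraph (residue1 g).
Proof.
split=> [x y|x]; first by rewrite !in_setD sg cover_symg.
by rewrite in_setD (negPf (ig x)) andbF.
Qed.

Lemma residue1_bound v : #|residue1 g v| <= d.
Proof. by apply: leq_trans (residue1_le v) (leq_pred _). Qed.

Lemma heavy_cover v : heavy g v -> #|cover g v| <= 1.
Proof.
move=> /eqP; rewrite card_residue1; have := dg v; have := d_gt1.
have := subset_leq_card (cover_sub v); clear; lia.
Qed.

Lemma second_matchingP u v : second_matching g u = Some v ->
  [/\ v \in residue1 g u, second_matching g v = Some u & heavy g u].
Proof.
move=> E; have [uv Ev] := matching_inP (proj1 residue1_sgraph) E.
by have [hu _] := matching_in_mem (proj1 residue1_sgraph) E.
Qed.

Lemma paths_sub : subgraph (paths g) g.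
Proof. by move=> x; apply/subsetP => y; rewrite inE => /andP[]. Qed.

Lemma paths_symg : symg (paths g).
Proof.
move=> x y; rewrite ![_ \in paths _ _]inE sg cover_symg; congr (_ && (_ || _)).
by apply/eqP/eqP => /second_matchingP[].
Qed.

Lemma paths_none v : second_matching g v = None -> paths g v = cover g v.
Proof.
move=> E; apply/setP => u; rewrite [in LHS]inE E orbF.
by have := subsetP (cover_sub v) u; case: (u \in cover g v) => [->|] //; rewrite andbF.
Qed.

Lemma card_paths v : #|paths g v| <= 2.
Proof.
case E: (second_matching g v) => [u|]; last first.
  by rewrite paths_none //; have [] := card_cover v.
have [_ _ /heavy_cover le1] := second_matchingP E.
apply: leq_trans (_ : #|cover g v :|: [set u]| <= _).
  apply/subset_leq_card/subsetP => w; rewrite [_ \in paths _ _]inE E => /andP[_].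
  by rewrite !in_setU in_set1 => /orP[->|/eqP[->]]; rewrite ?eqxx ?orbT.
by apply: leq_trans (leq_card_setU _ _) _; rewrite cards1 addn1.
Qed.

Lemma residue2_sub v : residue2 g v \subset residue1 g v.
Proof.
apply/subsetP => u; rewrite !in_setD => /andP[up uv]; rewrite uv andbT.
by apply: contra up => uc; rewrite inE uv uc.
Qed.

Lemma residue2_sgraph : sgraph (residue2 g).
Proof.
split=> [x y|x]; first by rewrite !in_setD sg paths_symg.
by rewrite in_setD (negPf (ig x)) andbF.
Qed.

Lemma residue2_le v : #|residue2 g v| <= d.-1.
Proof. by apply: leq_trans (subset_leq_card (residue2_sub v)) (residue1_le v). Qed.

(** The residual degree never exceeds [d - 1] and does not grow, so a needy vertex was heavy; an
    edge of the second matching would have lowered its residual degree further. *)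
Lemma needyP v : needy g v -> heavy g v /\ second_matching g v = None.
Proof.
move=> /eqP nv; have := subset_leq_card (residue2_sub v); rewrite nv => le.
have hv : heavy g v by rewrite /heavy eqn_leq le residue1_le.
split=> //; case E: second_matching => [u|] //; have [uv _ _] := second_matchingP E.
have : residue2 g v \subset residue1 g v :\ u.
  apply/subsetD1P; split; first exact: residue2_sub.
  rewrite in_setD in_setD in uv *; case/andP: uv => _ uv.
  by rewrite negb_and negbK inE uv E eqxx orbT.
move/subset_leq_card; rewrite nv; have := cardsD1 u (residue1 g v).
by rewrite uv (eqP hv); have := d_gt1; clear; lia.
Qed.

Lemma needy_paths v : needy g v -> #|paths g v| <= 1.
Proof. by move=> /needyP[hv E]; rewrite paths_none //; apply: heavy_cover. Qed.

Lemma needy_indep u v : needy g u -> needy g v -> v \notin residue2 g u.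
Proof.
move=> /needyP[hu Eu] /needyP[hv Ev]; apply/negP => /(subsetP (residue2_sub u)) uv.
have [|] := matching_in_max residue1_sgraph residue1_bound hu hv uv.
  by rewrite -/(second_matching g) Eu.
by rewrite -/(second_matching g) Ev.
Qed.

Lemma residue2_light v : ~~ needy g v -> #|residue2 g v| <= d.-2.
Proof.
rewrite /needy => nv; have := residue2_le v; rewrite leq_eqVlt (negPf nv) /=.
by have := d_gt1; clear; lia.
Qed.

End Correct.
End PathSystem.


(* Disjoint simple paths of [2 * D] vertices, one starting at each vertex of a
   ruling set from which there is such a path. *)
Section Windows.
Variables (V : finType) (m : nat) (key : V -> nat -> bool).
Hypothesis key_inj : forall u v, (forall b, b < m -> key u b = key v b) -> u = v.
Variable D : nat.
Hypothesis D_gt0 : 0 < D.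
Implicit Types (h : graph V) (x y z : V).

Definition tail_size := (D.*2).-1.

Lemma tail_sizeS : tail_size.+1 = D.*2.
Proof. by rewrite prednK // double_gt0. Qed.

Definition window h z : option (tail_size.-tuple V) :=
  if ruling m key (4 * D) h z then
    [pick p : tail_size.-tuple V | path (fun x y => y \in h x) z p && uniq (z :: p)]
  else None.

Definition slot h x : option (V * tail_size.-tuple V) :=
  [pick zp | [&& zp.1 \in ball h tail_size x, window h zp.1 == Some zp.2 &
              x \in zp.1 :: zp.2]].

Definition pos h x : nat := if slot h x is Some (z, p) then index x (z :: p) else 0.

Definition next2 h x : option V :=
  if slot h x is Some (z, p) then
    if index x (z :: p) + 2 < D.*2 then Some (nth z (z :: p) (index x (z :: p) + 2))
    else None
  else None.

Definition chained h x := slot h x != None.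

Lemma path_ball h z p i : path (fun x y => y \in h x) z p -> i <= size p ->
  nth z (z :: p) i \in ball h i z.
Proof.
move=> hp; elim: i => [|i IH] le_ip; first by rewrite inE.
apply: ball_step (IH (ltnW le_ip)) _.
by have /(pathP z)/(_ i le_ip) := hp.
Qed.

Lemma windowP h z p : window h z = Some p ->
  [/\ ruling m key (4 * D) h z, path (fun x y => y \in h x) z p & uniq (z :: p)].
Proof. by rewrite /window; case: ifP => // rz; case: pickP => // q /andP[hq uq] [<-]. Qed.

Lemma window_ball h z p x : window h z = Some p -> x \in z :: p -> x \in ball h tail_size z.
Proof.
move=> /windowP[_ hp _] xp; rewrite -(nth_index z xp).
have le : index x (z :: p) <= size p by have := index_mem x (z :: p); rewrite xp.
by apply: ball_leP (path_ball hp le); apply: leq_trans le _; rewrite size_tuple.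
Qed.

Lemma slotP h x z p : slot h x = Some (z, p) -> window h z = Some p /\ x \in z :: p.
Proof. by rewrite /slot; case: pickP => // -[z' p'] /and3P[_ /eqP /= w xz] [<- <-]. Qed.

(** Windows are disjoint: the starts of two windows through [x] are at distance at most
    [2 * tail_size], which is less than the separation [4 * D] of the ruling set. *)
Lemma slot_window h x z p : symg h -> window h z = Some p -> x \in z :: p ->
  slot h x = Some (z, p).
Proof.
move=> sh w xp; have xb := window_ball w xp; have zb := ball_sym sh xb.
rewrite /slot; case: pickP => [[z' p'] /and3P[/= zb' /eqP w' _]|/(_ (z, p))]; last first.
  by rewrite /= zb w eqxx xp.
suff zz' : z = z' by rewrite -zz' w in w' *; case: w' => ->.
have [rz _ _] := windowP w; have [rz' _ _] := windowP w'.
apply: (ruling_sep key_inj sh rz rz'); apply: ball_leP (ball_trans xb zb').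
by have := tail_sizeS; clear; lia.
Qed.

Lemma chainedP h x : chained h x -> exists z p, slot h x = Some (z, p).
Proof. by rewrite /chained; case: slot => // -[z p] _; exists z, p. Qed.

Lemma pos_lt h x : pos h x < D.*2.
Proof.
rewrite /pos; case E: slot => [[z p]|]; last by rewrite double_gt0.
have [_ xp] := slotP E; rewrite -index_mem /= size_tuple in xp.
by rewrite -tail_sizeS.
Qed.

Lemma pos_nth h z p i : symg h -> window h z = Some p -> i < D.*2 ->
  pos h (nth z (z :: p) i) = i.
Proof.
move=> sh w lt_i; have [_ _ up] := windowP w.
have lt_i' : i < size (z :: p) by rewrite /= size_tuple tail_sizeS.
by rewrite /pos (slot_window sh w) ?mem_nth // index_uniq.
Qed.

Lemma slot_nth h x z p : slot h x = Some (z, p) -> x = nth z (z :: p) (pos h x).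
Proof. by move=> E; have [_ xp] := slotP E; rewrite /pos E nth_index. Qed.

Lemma next2_nth h z p i : symg h -> window h z = Some p -> i < D.*2 ->
  next2 h (nth z (z :: p) i) = if i + 2 < D.*2 then Some (nth z (z :: p) (i + 2)) else None.
Proof.
move=> sh w lt_i; have [_ _ up] := windowP w.
have lt_i' : i < size (z :: p) by rewrite /= size_tuple tail_sizeS.
by rewrite /next2 (slot_window sh w) ?mem_nth // index_uniq.
Qed.

Lemma next2P h x y : symg h -> next2 h y = Some x ->
  exists z p, [/\ slot h y = Some (z, p), slot h x = Some (z, p) & pos h x = pos h y + 2].
Proof.
move=> sh; rewrite {1}/next2; case E: slot => [[z p]|] //; case: ifP => // lt [<-].
exists z, p; have [w yp] := slotP E; split=> //.
  by apply: slot_window => //; rewrite mem_nth //= size_tuple tail_sizeS.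
by rewrite pos_nth // /pos E.
Qed.

Lemma next2_inj h x y y' : symg h -> next2 h y = Some x -> next2 h y' = Some x -> y = y'.
Proof.
move=> sh /(next2P sh)[z [p [E1 E2 E3]]] /(next2P sh)[z' [p' [E1' E2' E3']]].
move: E2'; rewrite E2 => -[zz' pp']; subst z' p'.
rewrite (slot_nth E1) (slot_nth E1'); congr nth; apply/eqP.
by rewrite -(eqn_add2r 2) -E3 -E3'.
Qed.

Lemma next2_chained h x y : symg h -> next2 h y = Some x -> chained h y /\ chained h x.
Proof. by move=> sh /(next2P sh)[z [p [E1 E2 _]]]; rewrite /chained E1 E2. Qed.

Lemma next2_none h x : chained h x -> next2 h x = None -> (pos h x)./2 = D.-1.
Proof.
move=> /chainedP[z [p E]]; have pE : pos h x = index x (z :: p) by rewrite /pos E.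
rewrite /next2 E -pE; have := pos_lt h x.
case: (ltnP (pos h x + 2)) => // le lt _; move: le lt; clear; lia.
Qed.

Lemma prev2_exists h x : symg h -> chained h x -> 0 < (pos h x)./2 ->
  exists y, next2 h y = Some x.
Proof.
move=> sh /chainedP[z [p E]] gt0; have [w xp] := slotP E.
have ge2 : 2 <= pos h x by move: gt0; clear; lia.
exists (nth z (z :: p) (pos h x - 2)); have lt := pos_lt h x.
by rewrite next2_nth // ?subnK // ?lt -?(slot_nth E) //; apply: leq_ltn_trans lt; apply: leq_subr.
Qed.

Lemma next2_ball h x y : symg h -> next2 h y = Some x -> x \in ball h 2 y.
Proof.
move=> sh /(next2P sh)[z [p [E1 E2 E3]]]; have [/windowP[_ hp _] _] := slotP E1.
have lt := pos_lt h x; rewrite E3 -tail_sizeS in lt.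
have step i : i < tail_size -> nth z (z :: p) i.+1 \in h (nth z (z :: p) i).
  by move=> lt_i; have /(pathP z)/(_ i) := hp; rewrite size_tuple => /(_ lt_i).
rewrite [X in X \in _](slot_nth E2) E3 [X in ball h 2 X](slot_nth E1) addn2.
apply: ball_step (step _ _); last by move: lt; clear; lia.
by apply/ball_nbr/step; move: lt; clear; lia.
Qed.

(** The ruling set costs [m * (4 * D)] and the path from the start [tail_size]; locating the start
    from inside a window costs [tail_size] again. *)
Definition window_radius := m * (4 * D) + tail_size.
Definition slot_radius := window_radius + tail_size.

Lemma path_agree h h' z p : agree (size p) h h' z -> path (fun x y => y \in h x) z p ->
  path (fun x y => y \in h' x) z p.
Proof.
move=> ag hp; apply/(pathP z) => i lt_i; have /(pathP z)/(_ i lt_i) := hp.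
by rewrite ag //; apply: ball_leP (path_ball hp (ltnW lt_i)); apply: ltnW.
Qed.

Lemma window_local : local (@symg V) window_radius window.
Proof.
move=> h h' z sh sh' ag; rewrite /window (@ruling_local V m key (@symg V) (4 * D) h h' z sh sh'); last first.
  by apply: agree_le ag; apply: leq_addr.
case: ifP => // _; apply: eq_pick => p /=; congr (_ && _).
have agp : agree (size p) h h' z by apply: agree_le ag; rewrite size_tuple leq_addl.
by apply/idP/idP; apply: path_agree => //; apply: agree_sym.
Qed.

Lemma slot_local : local (@symg V) slot_radius slot.
Proof.
move=> h h' x sh sh' ag; rewrite /slot; apply: eq_pick => -[z p] /=.
have agb : agree tail_size h h' x by apply: agree_le ag; apply: leq_addl.
rewrite -(agree_ball_le agb (leqnSn _)); case: (boolP (z \in _)) => //= zb.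
by rewrite (local_near window_local sh sh' ag zb).
Qed.

End Windows.


(** * The Hall matching that gives needy vertices their targets and spares window vertices *)

Lemma sum_nat_eq1 (V : finType) (c : V -> nat) (y : V) :
  \sum_x c x * (x == y) = c y.
Proof.
rewrite (bigD1 y) //= eqxx muln1 big1 ?addn0 // => x /negPf ->.
by rewrite muln0.
Qed.

Arguments ball : simpl never.

Section Targets.
Variables (V : finType) (m : nat) (key : V -> nat -> bool).
Hypothesis key_inj : forall u v, (forall b, b < m -> key u b = key v b) -> u = v.
Hypothesis card_V : #|V| <= 2 ^ m.
Variable d : nat.
Hypothesis d_gt1 : 1 < d.
Implicit Types (g : graph V) (u v x y : V).

Local Notation cls := (@bounded_degree V d).
Local Notation paths := (paths m key d).
Local Notation residue2 := (residue2 m key d).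
Local Notation needy := (needy m key d).
Local Notation needy_radius := (needy_radius m d).

Definition rank_bound := 3 * d - 4.
Local Notation D := rank_bound.

Lemma rank_bound_gt1 : 1 < D.
Proof. by rewrite /D; have := d_gt1; clear; lia. Qed.

Lemma rank_bound_gt0 : 0 < D.
Proof. exact: ltnW rank_bound_gt1. Qed.

(** Only edges of the path system between vertices that are not needy may be cut later, so the
    windows are laid here. *)
Definition core g : graph V := induced (paths g) (fun v => ~~ needy g v).

Lemma core_sub g : subgraph (core g) g.
Proof. by move=> x; apply: subset_trans (paths_sub m key d g x); apply: induced_sub. Qed.

Lemma core_symg g : cls g -> symg (core g).
Proof. by move=> cg; apply/induced_symg/paths_symg. Qed.

Lemma core_local : local cls needy_radius.+1 core.
Proof.
apply: (@induced_local V cls needy_radius paths (fun g v => ~~ needy g v)).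
- by move=> g _; apply: paths_sub.
- exact: paths_local.
- by move=> g g' x cg cg' ag; rewrite (needy_local key cg cg' ag).
Qed.

Definition core_slot g := slot m key D (core g).
Definition core_next g := next2 m key D (core g).
Definition core_pos g := pos m key D (core g).
Definition core_chained g := chained m key D (core g).

Definition core_radius := needy_radius.+1 + slot_radius m D.

Lemma core_slot_local : local cls core_radius core_slot.
Proof.
apply: (@local_sub V cls (@symg V)); [exact: core_symg|by move=> g _; apply: core_sub|
  exact: core_local|exact: slot_local].
Qed.

Lemma core_next_local : local cls core_radius core_next.
Proof.
move=> g g' x cg cg' ag; have := core_slot_local cg cg' ag.
by rewrite /core_slot /core_next /next2 => ->.
Qed.

Lemma core_chained_local : local cls core_radius core_chained.
Proof.
move=> g g' x cg cg' ag; have := core_slot_local cg cg' ag.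
by rewrite /core_slot /core_chained /chained => ->.
Qed.

(* A needy vertex [inl n] may take a neighbor [inl r].  A vertex [inr x] of a
   window may take [inl x] itself, or one of the resources [inr y] shared by
   the vertices at distance two in the window.  Each of the two parity classes
   of a window has fewer shared resources than vertices, so that one of its
   vertices must take itself. *)
Definition may_take g (l r : V + V) : bool :=
  match l, r with
  | inl n, inl r => needy g n && (r \in residue2 g n)
  | inr x, inl r => (x == r) && core_chained g x
  | inr x, inr y => (x == y) && (core_next g x != None) || (core_next g y == Some x)
  | inl _, inr _ => false
  end.

Definition take_bip g : graph ((V + V) + (V + V))%type := fun w =>
  match w with
  | inl l => [set w | if w is inr r then may_take g l r else false]
  | inr r => [set w | if w is inl l then may_take g l r else false]
  end.

(** The left side has [2 * #|V|] elements, at most [2 ^ m.+1], hence the exponent [m.+2]. *)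
Definition assign g l := hall_matching D m.+2 (take_bip g) (inl l).

Definition target g n : option V :=
  if assign g (inl n) is Some (inl r) then Some r else None.

Lemma take_bip_symg g : symg (take_bip g).
Proof. by move=> [l|r] [l'|r']; rewrite !inE. Qed.

Definition host (w : (V + V) + (V + V)) : V :=
  match w with
  | inl (inl v) | inl (inr v) | inr (inl v) | inr (inr v) => v
  end.

Lemma needy_le_core : needy_radius <= core_radius.
Proof. by apply: leq_trans (leqnSn _) (leq_addr _ _). Qed.

Lemma residue2_subg g : subgraph (residue2 g) g.
Proof. by move=> x; apply: subsetDl. Qed.

Lemma take_bip_near g w w' : cls g -> w' \in take_bip g w -> host w' \in ball g 2 (host w).
Proof.
move=> cg; have [[sg _] _] := cg; have sc := core_symg cg.
have near (l r : V + V) : may_take g l r -> host (inr r) \in ball g 2 (host (inl l)).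
  case: l r => [n|x] [r|y] //=.
  - by move=> /andP[_ /(subsetP (residue2_subg g n))/ball_nbr rb]; apply: ball_leP rb.
  - by move=> /andP[/eqP -> _]; apply: ball_refl.
  - case/orP => [/andP[/eqP -> _]|/eqP nxt]; first exact: ball_refl.
    apply: ball_sym => //; apply: (subsetP (ball_subgraph 2 y (@core_sub g))).
    exact: (next2_ball key_inj rank_bound_gt0 sc nxt).
case: w w' => [l|r] [l'|r']; rewrite inE //; first exact: near.
by move=> /near; apply: ball_sym.
Qed.

Lemma take_local g g' l r : cls g -> cls g' ->
  agree (core_radius + 2) g g' (host (inl l)) -> may_take g l r -> may_take g' l r.
Proof.
move=> cg cg' ag; have ag0 : agree core_radius g g' (host (inl l)).
  by apply: agree_le ag; apply: leq_addr.
have agn := agree_le needy_le_core ag0.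
case: l r ag ag0 agn => [n|x] [r|y] //= ag ag0 agn.
- by rewrite (needy_local key cg cg' agn) (residue2_local key cg cg' agn).
- by rewrite (core_chained_local cg cg' ag0).
- rewrite (core_next_local cg cg' ag0); case/orP => [-> //|/eqP nxt]; apply/orP; right.
  have yx : y \in ball g 2 x.
    have [[sg _] _] := cg; apply: (subsetP (ball_subgraph 2 x (@core_sub g))).
    apply: ball_sym; first exact: core_symg.
    exact: (next2_ball key_inj rank_bound_gt0 (core_symg cg) nxt).
  by rewrite -(local_near core_next_local cg cg' ag yx) nxt.
Qed.

Lemma take_local_right g g' l r : cls g -> cls g' ->
  agree (core_radius + 2) g g' (host (inr r)) -> may_take g l r -> may_take g' l r.
Proof.
move=> cg cg' ag; have ag0 : agree core_radius g g' (host (inr r)).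
  by apply: agree_le ag; apply: leq_addr.
case: l r ag ag0 => [n|x] [r|y] //= ag ag0.
- move=> /andP[nn nr]; have [[sg _] _] := cg.
  have nb : n \in ball g 2 r.
    by apply: ball_leP (ball_nbr _) => //; rewrite sg; apply: (subsetP (residue2_subg g n)).
  have agn : agree needy_radius g g' n.
    by apply: agree_le (agree_sub ag nb); apply: needy_le_core.
  by rewrite -(needy_local key cg cg' agn) -(residue2_local key cg cg' agn) nn.
- by case/andP => /eqP ->; rewrite eqxx (core_chained_local cg cg' ag0).
- case/orP => [/andP[/eqP -> n0]|/eqP nxt].
    by rewrite eqxx -(core_next_local cg cg' ag0) n0.
  by rewrite -(core_next_local cg cg' ag0) nxt eqxx orbT.
Qed.

(** An edge of [take_bip] may join vertices at distance two, because shared resources skip one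
    vertex of the window; hence the factor 2 on the radius of the Hall matching. *)
Definition target_radius := core_radius + 2 + 2 * (structure_radius D m.+2).*2.+2.

Lemma needy_le_target : needy_radius <= target_radius.
Proof.
by apply: leq_trans needy_le_core _; rewrite /target_radius -addnA; apply: leq_addr.
Qed.

Lemma target_local : local cls target_radius target.
Proof.
move=> g g' x cg cg' ag; rewrite /target; suff -> : assign g (inl x) = assign g' (inl x) by [].
apply: (@local_host V _ host take_bip cls (@symg _) (core_radius + 2) 2 _ _ _ g g'
  (inl (inl x)) _ _ _ (@hall_matching_local (V + V)%type (V + V)%type D m.+2)) => //.
- by move=> g1 _; apply: take_bip_symg.
- move=> g1 g2 [l|r] cg1 cg2 ag1; apply/setP => -[l'|r']; rewrite !inE //.
    by apply/idP/idP; apply: take_local => //; apply: agree_sym.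
  by apply/idP/idP; apply: take_local_right => //; apply: agree_sym.
- by move=> g1 w w' cg1; apply: take_bip_near.
Qed.

(* With [D = 3 * d - 4], a needy vertex has weight [3 * (d - 1) = D + 1], and a
   vertex that is not needy has weight at most [3 * (d - 2) + 2 = D].  In a
   window, a shared resource splits its weight [D] between its two users so that
   each user ends up with [D + 1]. *)
Definition take_weight g (l r : V + V) : nat :=
  match l, r with
  | inl n, inl r => 3 * (needy g n && (r \in residue2 g n))
  | inr x, inl r => 2 * ((x == r) && core_chained g x)
  | inr x, inr y => (D.-1 - (core_pos g x)./2) * ((x == y) && (core_next g x != None))
                    + (core_pos g x)./2 * (core_next g y == Some x)
  | inl _, inr _ => 0
  end.

Section Correct.
Variable g : graph V.
Hypothesis cg : cls g.
Let sc : symg (core g). Proof. exact: core_symg. Qed.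

Lemma core_next_none x : core_chained g x -> core_next g x = None -> (core_pos g x)./2 = D.-1.
Proof. exact: (next2_none rank_bound_gt0). Qed.

Lemma take_weight_pos l r : 0 < take_weight g l r -> may_take g l r.
Proof.
case: l r => [n|x] [r|y] //=; rewrite ?muln_gt0 ?lt0b; [by case/andP|by case/andP|].
by rewrite addn_gt0 !muln_gt0 !lt0b => /orP[/andP[_ ->]|/andP[_ ->]]; rewrite ?orbT.
Qed.

Lemma take_weight_left l : right_nbrs (take_bip g) l != set0 -> D < \sum_r take_weight g l r.
Proof.
case/set0Pn => r0; rewrite !inE => tk; rewrite big_sumType /=; case: l tk => [n|x] /= tk.
  have nn : needy g n by case: r0 tk => // r /andP[].
  apply: leq_trans (leq_addr _ _); rewrite nn -big_distrr /=.
  have -> : \sum_r ((r \in residue2 g n) : nat) = #|residue2 g n|.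
    by rewrite -sum1_card [RHS]big_mkcond; apply: eq_bigr => r _; case: (r \in _).
  by rewrite (eqP nn) /D; have := d_gt1; clear; lia.
have cx : core_chained g x.
  case: r0 tk => [r /andP[] //|y /orP[/andP[_]|/eqP]].
    by rewrite /core_next /next2 /core_chained /chained; case: slot.
  by case/(next2_chained key_inj rank_bound_gt0 sc).
have real2 : \sum_y 2 * ((x == y) && core_chained g x) = 2.
  by apply: etrans (sum_nat_eq1 (fun=> 2) x); apply: eq_bigr => y _; rewrite cx andbT eq_sym.
rewrite real2 big_split /=.
(* With [i] half the position of [x], the three contributions are 2 from its own copy, [D - 1 - i]
   from its own resource and [i] from that of its predecessor, in total [D + 1]. A resource missing
   at an end of the window would have weight 0. *)
have own : D.-1 - (core_pos g x)./2 <=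
    \sum_y (D.-1 - (core_pos g x)./2) * ((x == y) && (core_next g x != None)).
  rewrite (bigD1 x) //= eqxx /=; apply: leq_trans (leq_addr _ _).
  by case: eqP => [/(core_next_none cx) -> |_]; rewrite ?subnn ?muln1.
have prev : (core_pos g x)./2 <= \sum_y (core_pos g x)./2 * (core_next g y == Some x).
  have [->|gt0] := posnP (core_pos g x)./2; first by [].
  have [y nxt] := prev2_exists key_inj rank_bound_gt0 sc cx gt0.
  rewrite (bigD1 y) //= [core_next g y]nxt eqxx muln1; exact: leq_addr.
have lt := pos_lt m key rank_bound_gt0 (core g) x; rewrite -/(core_pos g x) in lt.
apply: (leq_trans _ (leq_add (leqnn 2) (leq_add own prev))).
by move: lt; have := rank_bound_gt0; clear; lia.
Qed.

Lemma take_weight_right r : \sum_l take_weight g l r <= D.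
Proof.
rewrite big_sumType /=; case: r => [r|y] /=.
  have -> : \sum_x 2 * ((x == r) && core_chained g x) = 2 * core_chained g r.
    apply: etrans (sum_nat_eq1 (fun x => 2 * core_chained g x) r); apply: eq_bigr => x _.
    by rewrite -mulnA mulnb andbC.
  rewrite -big_distrr /=; set s := \sum_n _.
  have sE : s = #|[set n | needy g n && (r \in residue2 g n)]|.
    by rewrite -sum1_card [RHS]big_mkcond; apply: eq_bigr => n _; rewrite inE; case: (_ && _).
  have [rn|rn] := boolP (needy g r).
    have -> : s = 0.
      apply: big1 => n _; case: (boolP (needy g n)) => //= nn.
      by rewrite (negPf (needy_indep key_inj card_V d_gt1 cg nn rn)).
    by rewrite muln0 add0n; apply: leq_trans rank_bound_gt1; case: core_chained.
  have : s <= d.-2.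
    rewrite sE; apply: leq_trans (residue2_light key_inj card_V d_gt1 cg rn).
    apply/subset_leq_card/subsetP => n; rewrite inE => /andP[_].
    by rewrite (proj1 (residue2_sgraph m key cg)).
  by rewrite /D; have := d_gt1; case: core_chained; clear; lia.
rewrite big1_eq add0n big_split /=.
have -> : \sum_x (D.-1 - (core_pos g x)./2) * ((x == y) && (core_next g x != None)) =
    (D.-1 - (core_pos g y)./2) * (core_next g y != None).
  apply: etrans (sum_nat_eq1 (fun x => (D.-1 - (core_pos g x)./2) * (core_next g x != None)) y).
  by apply: eq_bigr => x _; rewrite -mulnA mulnb andbC.
(* If [y] has half position [i], its successor has [i + 1], and the resource receives
   [(D - 1 - i) + (i + 1) = D]. *)
case E: (core_next g y) => [x0|]; last first.
  by rewrite muln0 add0n big1 // => x _; rewrite muln0.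
have [z [p [_ _ px]]] := next2P key_inj rank_bound_gt0 sc E.
have -> : \sum_x (core_pos g x)./2 * (Some x0 == Some x) = (core_pos g x0)./2.
  by apply: etrans (sum_nat_eq1 (fun x => (core_pos g x)./2) x0); apply: eq_bigr => x _;
     rewrite eq_sym.
have lt := pos_lt m key rank_bound_gt0 (core g) x0; move: lt.
by rewrite /core_pos px muln1; have := rank_bound_gt0; clear; lia.
Qed.

Lemma assign_total l : right_nbrs (take_bip g) l != set0 -> exists r, assign g l = Some r.
Proof.
apply: hall_matching_total; first exact: take_bip_symg.
- exact: rank_bound_gt0.
- rewrite card_sum addnn -mul2n !expnS mulnA.
  by apply: leq_ltn_trans (_ : 2 * 2 ^ m < _); rewrite ?leq_mul2l // ltn_mul2r expn_gt0.
- move=> S; apply: (weight_expand (w := take_weight g)).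
  + by move=> k r /take_weight_pos tk; rewrite !inE.
  + exact: take_weight_left.
  + exact: take_weight_right.
Qed.

Lemma assignP l r : assign g l = Some r -> may_take g l r.
Proof. by move=> /hall_matching_edge; rewrite inE. Qed.

Lemma assign_inj l l' r : assign g l = Some r -> assign g l' = Some r -> l = l'.
Proof. exact: hall_matching_inj. Qed.

Lemma targetP n r : target g n = Some r -> needy g n /\ r \in residue2 g n.
Proof.
rewrite /target; case E: assign => [[r'|]|] // [<-].
by have /= /andP[] := assignP E.
Qed.

Lemma target_inj n n' r : target g n = Some r -> target g n' = Some r -> n = n'.
Proof.
rewrite /target; case E: assign => [[r1|]|] // [<-].
case E': assign => [[r2|]|] // [r12]; rewrite r12 in E'.
by have [] := assign_inj E E'.
Qed.

Lemma target_total n : needy g n -> exists r, target g n = Some r.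
Proof.
move=> nn; have [|r E] := @assign_total (inl n).
  have : 0 < #|residue2 g n| by rewrite (eqP nn); have := d_gt1; clear; lia.
  by case/card_gt0P => r nr; apply/set0Pn; exists (inl r); rewrite !inE /= nn.
by have := assignP E; rewrite /target E; case: r {E} => // r _; exists r.
Qed.

(** Pigeonhole in one parity class: its [D] vertices share [D - 1] resources, so one of them takes
    its own copy, which by injectivity is then no target. *)
Lemma window_untouched z p par : window m key D (core g) z = Some p -> par < 2 ->
  exists2 j, j < D & forall n, target g n != Some (nth z (z :: p) (j.*2 + par)).
Proof.
move=> w lt_par; have D0 := rank_bound_gt0.
pose x j := nth z (z :: p) (j.*2 + par).
have [/existsP[j]|] := boolP [exists j : 'I_D, assign g (inr (x j)) == Some (inl (x j))].
  move=> /eqP E; exists j; rewrite ?ltn_ord // => n; apply/eqP; rewrite /target.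
  by case E': assign => [[r|]|] // [rx]; rewrite rx in E'; have := assign_inj E E'.
rewrite negb_exists => /forallP none.
have lt_j j : j < D -> j.*2 + par < D.*2 by move: lt_par; clear; lia.
have slotx j : j < D -> core_slot g (x j) = Some (z, p).
  move=> /lt_j lt; apply: (slot_window key_inj D0 sc w).
  by rewrite mem_nth //= size_tuple tail_sizeS.
have posx j : j < D -> core_pos g (x j) = j.*2 + par.
  by move=> /lt_j lt; apply: (pos_nth key_inj D0 sc w).
have nextx j : j.+1 < D -> core_next g (x j) = Some (x j.+1).
  move=> lt; rewrite /core_next (next2_nth key_inj D0 sc w) ?lt_j ?(ltnW lt) //.
  have -> : j.*2 + par + 2 = j.+1.*2 + par by clear; lia.
  by rewrite lt_j.
have next_last : core_next g (x D.-1) = None.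
  rewrite /core_next (next2_nth key_inj D0 sc w) ?lt_j ?prednK //.
  by case: ltnP => //; move: D0; clear; lia.
(* If nobody takes itself, everybody takes its own resource: the first vertex has no predecessor,
   and each later one finds the resource of its predecessor taken. The last vertex has no resource,
   a contradiction. *)
have takes j : j < D -> assign g (inr (x j)) = Some (inr (x j)) /\ core_next g (x j) != None.
  elim: j => [|j IH] lt_jD.
    have [|r E] := @assign_total (inr (x 0)).
      by apply/set0Pn; exists (inl (x 0)); rewrite !inE /= eqxx;
        rewrite /core_chained /chained [slot _ _ _ _ _]slotx.
    have := assignP E; case: r E => [r|y] E /=.
      by move=> /andP[/eqP xr _]; have := none (Ordinal lt_jD); rewrite E -xr eqxx.
    case/orP => [/andP[/eqP xy n0]|/eqP nxt]; first by split; first by rewrite E xy.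
    have [z' [p' [_ _]]] := next2P key_inj D0 sc nxt.
    by rewrite -/(core_pos g _) posx //; move: lt_par; clear; lia.
  have [|r E] := @assign_total (inr (x j.+1)).
    by apply/set0Pn; exists (inl (x j.+1)); rewrite !inE /= eqxx;
        rewrite /core_chained /chained [slot _ _ _ _ _]slotx.
  have := assignP E; case: r E => [r|y] E /=.
    by move=> /andP[/eqP xr _]; have := none (Ordinal lt_jD); rewrite E -xr eqxx.
  case/orP => [/andP[/eqP xy n0]|/eqP nxt]; first by split; first by rewrite E xy.
  have yx := next2_inj key_inj D0 sc nxt (nextx _ lt_jD).
  have [Ej _] := IH (ltnW lt_jD).
  rewrite yx in E; have [xx] := assign_inj E Ej.
  by have := posx _ lt_jD; rewrite xx posx ?(ltnW lt_jD) //; clear; lia.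
by have [|_] := takes D.-1; rewrite ?next_last // prednK.
Qed.

End Correct.
End Targets.


(** * One step: three matchings that lower the maximum degree by two *)

Definition uncolored (V : finType) (S : graph V -> V -> {ffun V -> option nat})
    (g : graph V) : graph V :=
  fun v => [set u in g v | S g v u == None].

Section Step.
Variables (V : finType) (m : nat) (key : V -> nat -> bool).
Hypothesis key_inj : forall u v, (forall b, b < m -> key u b = key v b) -> u = v.
Variables (d D : nat).
Hypothesis D_gt0 : 0 < D.
Implicit Types (g : graph V) (u v x y : V).

Local Notation cls := (@bounded_degree V d).

(** The path system and the targets enter only through the properties assumed here; [peeling]
    supplies the actual constructions. *)
Variables (paths core : graph V -> graph V) (needy : graph V -> pred V).
Variables (target : graph V -> V -> option V) (target_radius : nat).
Hypothesis paths_local : local cls target_radius paths.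
Hypothesis core_local : local cls target_radius core.
Hypothesis needy_local : local cls target_radius needy.
Hypothesis target_local : local cls target_radius target.
Hypothesis paths_sub : forall g, subgraph (paths g) g.
Hypothesis paths_symg : forall g, cls g -> symg (paths g).
Hypothesis coreE : forall g v u,
  (u \in core g v) = [&& u \in paths g v, ~~ needy g v & ~~ needy g u].
Hypothesis card_paths : forall g v, cls g -> #|paths g v| <= 2.
Hypothesis needy_paths : forall g v, cls g -> needy g v -> #|paths g v| <= 1.
Hypothesis window_untouched : forall g z p par, cls g ->
  window m key D (core g) z = Some p -> par < 2 ->
  exists2 j, j < D & forall n, target g n != Some (nth z (z :: p) (j.*2 + par)).
Hypothesis residue_le : forall g v, cls g -> #|g v :\: paths g v| <= d.-1.
Hypothesis residue_light : forall g v, cls g -> ~~ needy g v -> #|g v :\: paths g v| <= d.-2.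
Hypothesis needy_indep : forall g u v, cls g -> needy g u -> needy g v ->
  v \notin g u :\: paths g u.
Hypothesis targetP : forall g n r, cls g -> target g n = Some r ->
  needy g n /\ r \in g n :\: paths g n.
Hypothesis target_inj : forall g n n' r, cls g ->
  target g n = Some r -> target g n' = Some r -> n = n'.
Hypothesis target_total : forall g n, cls g -> needy g n -> exists r, target g n = Some r.

Lemma core_paths g v : core g v \subset paths g v.
Proof. by apply/subsetP => u; rewrite coreE => /andP[]. Qed.

Lemma core_in_graph g : subgraph (core g) g.
Proof. by move=> v; apply: subset_trans (core_paths g v) (paths_sub g v). Qed.

Lemma core_symmetric g : cls g -> symg (core g).
Proof. by move=> cg x y; rewrite !coreE paths_symg // [~~ _ && _]andbC. Qed.

Definition clients g v := [set n in g v | target g n == Some v].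

(** Since every needy vertex has a target, these are the vertices covered by the matching formed by
    the target edges. *)
Definition touched g : pred V :=
  fun v => needy g v || (clients g v != set0).

Definition uniform g : graph V := fun v => [set u in core g v | touched g v == touched g u].

(** Cutting along a matching costs each vertex at most one path edge, which [card_remainder] can
    afford. The bound 2 is the maximum degree of the path system. *)
Definition cut g := maximal_matching m key 2 (uniform g).

Definition pieces g : graph V := fun v => [set u in paths g v | cut g v != Some u].

(** From the middle of a path, a ruling vertex of the core is within distance [m * (4 * D)], and a
    window starting there reaches less than [D.*2] further. *)
Definition half_length := m * (4 * D) + D.*2.
Definition piece_bound := half_length.*2.+2.

Definition third_color g v u :=
  [|| target g v == Some u, target g u == Some v | (cut g v == Some u) && ~~ touched g v].

(** The colors are 0 and 1 on the pieces and 2 for the third matching; [None] leaves an edge to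
    later steps. *)
Definition step_color g v : {ffun V -> option nat} :=
  [ffun u => if u \notin g v then None
             else if u \in pieces g v then
               Some (edge_color piece_bound (pieces g) (touched g) v u : nat)
             else if third_color g v u then Some 2 else None].

Definition pieces_radius := target_radius.+2 + m * (2 * 3).
Definition step_radius := pieces_radius + piece_bound.

Lemma touched_local : local cls target_radius.+1 touched.
Proof.
move=> g g' x cg cg' ag; have gx : g x = g' x := ag x (ball_refl _ _ _).
have agn : agree target_radius g g' x by apply: agree_le ag.
rewrite /touched (needy_local cg cg' agn).
suff -> : clients g x = clients g' x by [].
apply/setP => n; rewrite /clients !in_set -gx.
case: (boolP (n \in g x)) => nx; last by rewrite !andFb.
rewrite -addn1 in ag; have nb := ball_nbr nx.
by rewrite (local_near target_local cg cg' ag nb).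
Qed.

Lemma uniform_sub g : subgraph (uniform g) (core g).
Proof. by move=> v; apply/subsetP => u; rewrite inE => /andP[]. Qed.

Lemma uniform_local : local cls target_radius.+2 uniform.
Proof.
move=> g g' x cg cg' ag.
have ag1 : agree target_radius.+1 g g' x by apply: agree_le ag.
have cx := core_local cg cg' (agree_le (leqnSn _) ag1); have tx := touched_local cg cg' ag1.
rewrite -addn1 in ag.
have tu u : u \in core g x -> touched g u = touched g' u.
  move=> ux; apply: (local_near touched_local cg cg' ag).
  exact: ball_nbr (subsetP (core_in_graph g x) u ux).
apply/setP => u; rewrite /uniform !in_set -cx tx.
by case: (boolP (u \in core g x)) => [/tu ->|_]; rewrite ?andFb.
Qed.

Lemma cut_local : local cls pieces_radius cut.
Proof.
apply: (@local_sub V cls (fun=> True)) => //.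
- by move=> g _ x; exact: subset_trans (uniform_sub g x) (core_in_graph g x).
- exact: uniform_local.
- exact: maximal_matching_local.
Qed.

Lemma target_le_pieces : target_radius.+2 <= pieces_radius.
Proof. exact: leq_addr. Qed.

Lemma paths_local' : local cls pieces_radius paths.
Proof. by apply: local_le paths_local; apply: leq_trans target_le_pieces; apply/leqW/leqW. Qed.

Lemma pieces_local : local cls pieces_radius pieces.
Proof.
by move=> g g' x cg cg' ag; rewrite /pieces (paths_local' cg cg' ag) (cut_local cg cg' ag).
Qed.

Lemma touched_local' : local cls pieces_radius touched.
Proof. by apply: local_le touched_local; apply: leq_trans target_le_pieces. Qed.

Section Correct.
Variable g : graph V.
Hypothesis cg : cls g.
Let sg : symg g. Proof. by have [[]] := cg. Qed.
Let ig : forall v, v \notin g v. Proof. by have [[]] := cg. Qed.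
Let sp : symg (paths g). Proof. exact: paths_symg. Qed.
Let sc : symg (core g). Proof. exact: core_symmetric. Qed.

Lemma coreP v u : u \in core g v -> [/\ u \in paths g v, ~~ needy g v & ~~ needy g u].
Proof. by rewrite coreE => /and3P[]. Qed.

Lemma uniform_symg : symg (uniform g).
Proof. by move=> x y; rewrite !in_set sc eq_sym. Qed.

Lemma cutP v u : cut g v = Some u ->
  [/\ u \in core g v, touched g v = touched g u & cut g u = Some v].
Proof.
move=> /(maximal_matching_matching uniform_symg)[].
by rewrite inE => /andP[uv /eqP].
Qed.

Lemma cut_max v u : u \in uniform g v -> cut g v != None \/ cut g u != None.
Proof.
move=> uv; have uc := subsetP (uniform_sub g v) u uv.
apply: (maximal_matchingP key_inj uniform_symg) => // [w|].
  apply: leq_trans (card_paths w cg); apply: subset_leq_card.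
  exact: subset_trans (uniform_sub g w) (core_paths g w).
by apply: contraTneq (subsetP (core_in_graph g v) u uc) => <-; apply: ig.
Qed.

Lemma pieces_sub : subgraph (pieces g) (paths g).
Proof. by move=> v; apply/subsetP => u; rewrite inE => /andP[]. Qed.

Lemma pieces_sgraph : sgraph (pieces g).
Proof.
split=> [x y|x]; last first.
  apply/negP => /(subsetP (pieces_sub x))/(subsetP (paths_sub g x)).
  by apply/negP/ig.
rewrite ![_ \in pieces _ _]inE sp; congr (_ && ~~ _).
by apply/eqP/eqP => /cutP[].
Qed.

Lemma card_pieces v : #|pieces g v| <= 2.
Proof.
by apply: leq_trans (card_paths v cg); apply/subset_leq_card/pieces_sub.
Qed.

(** Two edges are all that the path system has at a vertex, so none was cut; a needy vertex has at
    most one. *)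
Lemma pieces_inner v : #|pieces g v| = 2 ->
  [/\ pieces g v = paths g v, cut g v = None & ~~ needy g v].
Proof.
move=> dv; have eqp : pieces g v = paths g v.
  by apply/eqP; rewrite eqEcard pieces_sub dv card_paths.
split=> //.
  case E: (cut g v) => [u|] //; have [/coreP[uv _ _] _ _] := cutP E.
  by rewrite -eqp inE E eqxx andbF in uv.
by apply/negP => /(needy_paths cg); rewrite -eqp dv.
Qed.

(** Otherwise the edge would be uniform with both ends uncut, against the maximality of the cuts. *)
Lemma pieces_alternate a b : b \in pieces g a -> #|pieces g a| = 2 -> #|pieces g b| = 2 ->
  touched g a != touched g b.
Proof.
move=> ab /pieces_inner[_ ca na] /pieces_inner[_ cb nb].
apply/negP => eq_ab; have [] := @cut_max a b; rewrite ?ca ?cb // inE eq_ab andbT.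
by rewrite coreE na nb (subsetP (pieces_sub a)).
Qed.

Section LongPath.
Variables (x : V) (p : seq V).
Hypotheses (hp : path (fun x y => y \in pieces g x) x p) (up : uniq (x :: p)).
Hypothesis long_p : piece_bound <= size p.
Let s i := nth x (x :: p) i.

Let s_inj i j : i <= size p -> j <= size p -> s i = s j -> i = j.
Proof. by move=> le_i le_j /eqP; rewrite nth_uniq // => /eqP. Qed.

Let s_step i : i < size p -> s i.+1 \in pieces g (s i).
Proof. by move=> lt_i; have /(pathP x)/(_ i lt_i) := hp. Qed.

Let inner i : i.+1 < size p -> pieces g (s i.+1) = [set s i; s i.+2].
Proof.
move=> lt_i; apply/esym/eqP; rewrite eqEcard subUset !sub1set s_step //.
rewrite (proj1 pieces_sgraph) s_step ?(ltnW lt_i) //=.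
rewrite cards2; have -> : s i != s i.+2.
  by apply/eqP => /s_inj; have := lt_i; clear; lia.
exact: card_pieces.
Qed.

Let card_inner i : i.+1 < size p -> #|pieces g (s i.+1)| = 2.
Proof.
move=> lt_i; rewrite inner // cards2; have -> // : s i != s i.+2.
by apply/eqP => /s_inj; have := lt_i; clear; lia.
Qed.

Let inner_facts i : 0 < i < size p ->
  [/\ pieces g (s i) = paths g (s i), cut g (s i) = None & ~~ needy g (s i)].
Proof. by case: i => // i /card_inner; apply: pieces_inner. Qed.

Let core_step i : 0 < i -> i.+1 < size p -> s i.+1 \in core g (s i).
Proof.
move=> i0 lt_i; have [|eqp _ ni] := @inner_facts i; first by rewrite i0 ltnW.
have [|_ _ ni'] := @inner_facts i.+1; first by [].
by rewrite coreE -eqp s_step ?(ltnW lt_i) // ni ni'.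
Qed.

(** At inner vertices of [p] the core has no edges besides those of [p], so a ball grows along [p]
    as long as it stays away from the ends. *)
Let core_ball c k y : k < c -> c + k < size p -> y \in ball (core g) k (s c) ->
  exists2 j, c - k <= j <= c + k & y = s j.
Proof.
elim: k y => [|k IH] y lt_k lt_c; first by rewrite inE => /eqP ->; exists c; rewrite // subn0 addn0 leqnn.
have lt_k' : k < c by apply: ltnW.
have lt_c' : c + k < size p by apply: leq_trans lt_c; rewrite addnS ltnS ltnW.
case/ballSP => w /(IH _ lt_k' lt_c')[j jk ->] [->|/coreP[wy _ _]].
  by exists j => //; move: jk; clear; lia.
have j0 : 0 < j < size p by move: jk lt_k lt_c; clear; lia.
have [eqp _ _] := inner_facts j0; move: wy; rewrite -eqp.
case: j j0 jk {eqp} => // j /andP[_ lt_j] jk; rewrite inner // !inE => /orP[] /eqP ->.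
  by exists j => //; move: jk; clear; lia.
by exists j.+2 => //; move: jk; clear; lia.
Qed.

(** A ruling vertex near the middle of [p] starts a window inside [p]. By [window_untouched] the
    window does not alternate, so it contains a uniform edge; as inner vertices are uncut, this
    contradicts the maximality of the cuts. *)
Lemma long_path_absurd : False.
Proof.
have D0 := D_gt0.
(* The extra unit keeps the two ends of [p] out of reach: only inner vertices have both path
   neighbors on [p]. *)
pose c := half_length.+1.
have [z rz zb] := @ruling_dom V m key (4 * D) (core g) (s c).
have leR : m * (4 * D) + D.*2 = half_length by [].
have lp : half_length.*2.+2 <= size p := long_p.
have [||j jc zE] := core_ball _ _ zb; [by rewrite /c -leR; clear; lia|
  by rewrite /c; move: lp; rewrite -leR; clear; lia|].
have inside i : i < D.*2 -> 0 < j + i /\ (j + i).+1 < size p.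
  by move: jc lp; rewrite /c -leR; clear; lia.
(* The stretch of [p] that follows [z] shows that a window at [z] exists. *)
have [q w] : exists q, window m key D (core g) z = Some q.
  rewrite /window [ruling _ _ _ _ _]rz.
  have szq : size (take (tail_size D) (drop j p)) == tail_size D.
    rewrite size_take size_drop; case: ltnP => // le.
    have [|_ H] := inside (tail_size D); first by rewrite -tail_sizeS.
    by move: le H; clear; lia.
  case: pickP => [q _|/(_ (Tuple szq))]; first by exists q.
  have nthE i : i <= tail_size D -> nth z (z :: take (tail_size D) (drop j p)) i = s (j + i).
    case: i => [|i] lt_i /=; first by rewrite addn0.
    have lt_ip : j + i < size p.
      have [|_ H] := inside i.+1; first by rewrite -tail_sizeS.
      by move: H; clear; lia.
    by rewrite nth_take // nth_drop addnS /s /=; apply: set_nth_default.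
  have szs : size (take (tail_size D) (drop j p)) = tail_size D by apply/eqP.
  rewrite /= -[_ && uniq _]/(uniq (z :: take (tail_size D) (drop j p))).
  move=> /negP[]; apply/andP; split.
    apply/(pathP z) => i; rewrite szs => lt_i.
    rewrite -[nth z (take _ _) i]/(nth z (z :: take (tail_size D) (drop j p)) i.+1).
    rewrite !nthE ?(ltnW lt_i) // addnS.
    have [|H1 H2] := inside i; first by rewrite -tail_sizeS // ltnW.
    exact: core_step.
  apply/(uniqP z) => a b; rewrite !inE /= szs !ltnS => le_a le_b; rewrite !nthE //.
  have [|_ Ha] := inside a; first by rewrite -tail_sizeS.
  have [|_ Hb] := inside b; first by rewrite -tail_sizeS.
  by move=> /s_inj; move: Ha Hb; clear; lia.
(* The window that is picked need not be that stretch, but the core around [z] confines it to the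
   interior of [p]. *)
have q_inside i : i < D.*2 -> exists2 k, 0 < k < size p & nth z (z :: q) i = s k.
  move=> lt_i.
  have qb : nth z (z :: q) i \in ball (core g) (tail_size D) z.
    by apply: (window_ball w); rewrite mem_nth //= size_tuple tail_sizeS.
  have := ball_trans zb qb; have ts := tail_sizeS D0.
  case/core_ball => [||k kc ->]; [by rewrite /c -leR -ts; clear; lia|
    by rewrite /c; move: lp; rewrite -leR -ts; clear; lia|].
  by exists k => //; move: kc lp; rewrite /c -leR -ts; clear; lia.
have [i lt_i eq_i] : exists2 i, i.+1 < D.*2 &
    touched g (nth z (z :: q) i) = touched g (nth z (z :: q) i.+1).
  have [/existsP[i /andP[lt_i /eqP eq_i]]|none] :=
    boolP [exists i : 'I_(D.*2), (i.+1 < D.*2) &&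
      (touched g (nth z (z :: q) i) == touched g (nth z (z :: q) i.+1))].
    by exists i.
  have alt i : i < D.*2 -> touched g (nth z (z :: q) i) = touched g z (+) odd i.
    elim: i => [|i IH] lt_i; first by rewrite addbF.
    move: none; rewrite negb_exists => /forallP/(_ (Ordinal (ltnW lt_i))).
    rewrite lt_i IH ?(ltnW lt_i) //= => neq.
    by move: neq; case: (touched g z); case: (odd i); case: (touched g _).
  (* Under alternation the parity of the position decides who is touched; an untouched vertex in
     each parity class refutes this. *)
  have off par : par < 2 -> touched g z (+) odd par = false.
    move=> lt_par; have [k lt_k untouched] := window_untouched cg w lt_par.
    have lt_kp : k.*2 + par < D.*2 by move: lt_k lt_par; clear; lia.
    have := alt _ lt_kp; rewrite oddD odd_double addFb => <-.
    have [a a_in aE] := q_inside _ lt_kp; have [_ _ na] := inner_facts a_in.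
    rewrite /touched aE (negPf na) /= -aE; apply/negbTE; rewrite negbK; apply/eqP/setP => n.
    by rewrite !inE (negPf (untouched n)) andbF.
  by have := off 0 isT; have := off 1 isT; case: (touched g z).
have [a a_in aE] := q_inside _ (ltnW lt_i); have [_ ca na] := inner_facts a_in.
have [b b_in bE] := q_inside _ lt_i; have [_ cb nb] := inner_facts b_in.
have [_ hq _] := windowP w.
have lt_iq : i < size q by rewrite size_tuple -ltnS tail_sizeS.
have := (pathP z hq) i lt_iq; rewrite -[nth z q i]/(nth z (z :: q) i.+1) => ab.
have [] := @cut_max (s a) (s b); rewrite ?ca ?cb // -aE -bE.
by rewrite inE eq_i eqxx andbT.
Qed.

End LongPath.

Lemma pieces_bounded : bounded_components piece_bound (pieces g).
Proof.
move=> x y /connectP[p hp ->]; have [q hq uq _] := shortenP hp.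
have lt_q : size q < piece_bound.
  by rewrite ltnNge; apply/negP; apply: long_path_absurd hq uq.
have := path_ball hq (leqnn _); rewrite -last_nth => lb.
by apply: ball_leP lb; apply: ltnW.
Qed.

Lemma target_not_needy n r : target g n = Some r -> ~~ needy g r.
Proof.
move=> E; have [nn nr] := targetP cg E; apply/negP => rn.
by rewrite (negPf (needy_indep cg nn rn)) in nr.
Qed.

Lemma target_touched n r : target g n = Some r -> touched g r.
Proof.
move=> E; have [_ /setDP[nr _]] := targetP cg E.
by rewrite /touched; apply/orP; right; apply/set0Pn; exists n; rewrite inE E eqxx -sg nr.
Qed.

Lemma third_colorC v u : third_color g v u = third_color g u v.
Proof.
rewrite /third_color orbCA; congr [|| _, _ | _].
apply/andP/andP => -[/eqP E tv]; have [_ <- Eu] := cutP E; by rewrite Eu eqxx.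
Qed.

(** The target edges form a matching between needy vertices and touched vertices that are not needy;
    the colored cuts form a matching on vertices that are neither needy nor touched. *)
Lemma third_color_inj v u w : third_color g v u -> third_color g v w -> u = w.
Proof.
have ncut x y : cut g x = Some y -> ~~ needy g x by case/cutP => /coreP[].
case/or3P => [/eqP E|/eqP E|/andP[/eqP E tv]];
  case/or3P => [/eqP E'|/eqP E'|/andP[/eqP E' tv']].
- by move: E'; rewrite E => -[].
- by have := target_not_needy E'; have [-> _] := targetP cg E.
- by have := ncut _ _ E'; have [-> _] := targetP cg E.
- by have := target_not_needy E; have [-> _] := targetP cg E'.
- exact: target_inj cg E E'.
- by rewrite (target_touched E) in tv'.
- by have := ncut _ _ E; have [-> _] := targetP cg E'.
- by rewrite (target_touched E') in tv.
- by move: E'; rewrite E => -[].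
Qed.

Lemma step_color_sym v u : u \in g v -> step_color g v u = step_color g u v.
Proof.
have pE : (u \in pieces g v) = (v \in pieces g u) := proj1 pieces_sgraph v u.
move=> uv; rewrite !ffunE uv -sg uv /= third_colorC -pE.
case: ifP => // pv; congr (Some (nat_of_bool _)).
exact: (edge_color_sym (touched g) pieces_sgraph card_pieces pieces_bounded pv).
Qed.

Lemma step_color_edge v u c : step_color g v u = Some c -> u \in g v.
Proof. by rewrite ffunE; case: (u \in g v). Qed.

Lemma step_color_lt3 v u c : step_color g v u = Some c -> c < 3.
Proof.
rewrite ffunE; case: ifP => // _; case: ifP => _; first by case=> <-; case: edge_color.
by case: ifP => // _ [<-].
Qed.

Lemma step_color_proper v u w c :
  step_color g v u = Some c -> step_color g v w = Some c -> u = w.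
Proof.
have lt2 (b : bool) : Some (b : nat) <> Some 2 by case: b.
rewrite !ffunE; case: ifP => // _; case: ifPn => [pu|pu].
  move=> Eu; case: ifP => // _; case: ifPn => [pw|pw].
    rewrite -Eu => -[E]; apply/eqP/negPn/negP => neq.
    have := edge_color_proper pieces_sgraph card_pieces pieces_bounded pieces_alternate pu pw neq.
    by move: E; do 2 case: edge_color.
  by case: ifP => // _ E2; case: (lt2 _ (etrans Eu (esym E2))).
case: ifP => // tu [<-]; case: ifP => // _; case: ifPn => [pw /lt2 //|pw].
by case: ifP => // tw _; apply: third_color_inj tu tw.
Qed.

Local Notation remainder := (uncolored step_color).

Lemma remainder_residue v :
  remainder g v \subset (g v :\: paths g v) :|: [set u | (cut g v == Some u) && touched g v].
Proof.
apply/subsetP => u; rewrite inE ffunE => /andP[uv]; rewrite uv /=.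
case: ifPn => // pu; case: ifPn => // tu _; rewrite in_setU in_setD uv andbT.
move: pu; rewrite [u \in pieces g v]inE negb_and negbK => /orP[-> //|E]; apply/orP; right.
by rewrite inE E; move: tu; rewrite /third_color E; case: (touched g v); rewrite ?orbT.
Qed.

Lemma remainder_third v u : u \in remainder g v -> ~~ third_color g v u.
Proof.
rewrite inE ffunE => /andP[uv]; rewrite uv /=; case: ifP => [//|_].
by case: third_color.
Qed.

(** A needy vertex has no cut, and its target edge lowers [d - 1] to [d - 2]. Any other vertex has
    residual degree at most [d - 2]: if untouched, its cut edge is colored; if touched, the edge to
    a client makes up for the dropped cut edge. *)
Lemma card_remainder v : 1 < d -> #|remainder g v| <= d.-2.
Proof.
move=> d1; have [nv|nv] := boolP (needy g v).
  have [r E] := target_total cg nv; have [_ rv] := targetP cg E.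
  have sub : remainder g v \subset (g v :\: paths g v) :\ r.
    apply/subsetD1P; split; last first.
      by apply/negP => /remainder_third; rewrite /third_color E eqxx.
    apply: subset_trans (remainder_residue v) _; rewrite subUset subxx.
    apply/subsetP => u; rewrite inE => /andP[/eqP /cutP[/coreP[_]]].
    by rewrite nv.
  apply: leq_trans (subset_leq_card sub) _.
  have := cardsD1 r (g v :\: paths g v); rewrite rv; have := residue_le v cg.
  by clear; lia.
have lev := residue_light cg nv.
have [tv|tv] := boolP (touched g v); last first.
  apply: leq_trans lev; apply: subset_leq_card.
  apply: subset_trans (remainder_residue v) _; rewrite subUset subxx.
  by apply/subsetP => u; rewrite inE (negPf tv) andbF.
have [n] : exists n, n \in clients g v by apply/set0Pn; move: tv; rewrite /touched (negPf nv).
rewrite inE => /andP[nv' /eqP E]; have [_ vn] := targetP cg E.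
have nres : n \in g v :\: paths g v.
  by move: vn; rewrite !in_setD sg sp.
have sub : remainder g v \subset ((g v :\: paths g v) :\ n) :|: [set u | cut g v == Some u].
  apply/subsetP => u ur; have := subsetP (remainder_residue v) u ur.
  rewrite in_setU => /orP[ures|]; last by rewrite !inE => /andP[-> _]; rewrite orbT.
  rewrite in_setU in_setD1 ures andbT; apply/orP; left.
  by apply: contraNneq (remainder_third ur) => ->; rewrite /third_color E eqxx orbT.
apply: leq_trans (subset_leq_card sub) _; apply: leq_trans (leq_card_setU _ _) _.
have le1 : #|[set u | cut g v == Some u]| <= 1.
  by apply/card_le1_eqP => a b; rewrite !inE => /eqP -> /eqP[].
have := cardsD1 n (g v :\: paths g v); rewrite nres; move: lev le1; clear; lia.
Qed.

End Correct.

Lemma step_color_local : local cls step_radius step_color.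
Proof.
move=> g g' x cg cg' ag; have gx : g x = g' x := ag x (ball_refl _ _ _).
have agp : agree pieces_radius g g' x by apply: agree_le ag; apply: leq_addr.
have agt : agree target_radius g g' x.
  by apply: agree_le agp; apply: leq_trans target_le_pieces; apply/leqW/leqW.
have near y : y \in ball (pieces g) piece_bound x -> y \in ball g piece_bound x.
  apply: (subsetP (ball_subgraph _ _ _)) => v.
  exact: subset_trans (pieces_sub g v) (paths_sub g v).
have agt1 : agree (target_radius + 1) g g' x.
  apply: agree_le agp; rewrite addn1; apply: leq_trans target_le_pieces; exact: leqW.
have px := pieces_local cg cg' agp; have tx := touched_local' cg cg' agp.
apply/ffunP => u; rewrite !ffunE -gx -px.
case: (boolP (u \in g x)) => //= ux; case: ifPn => [pu|_].
  congr (Some (nat_of_bool _)); apply: edge_color_ext => //.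
  - exact: pieces_bounded.
  - by move=> y /near yb; apply: (local_near pieces_local cg cg' ag yb).
  - by move=> y /near yb; apply: (local_near touched_local' cg cg' ag yb).
rewrite /third_color (target_local cg cg' agt) (cut_local cg cg' agp) -tx.
by rewrite (local_near target_local cg cg' agt1 (ball_nbr ux)).
Qed.

Lemma step_color_spec : 1 < d ->
  local cls step_radius step_color /\
  forall g, cls g ->
    [/\ forall v u, u \in g v -> step_color g v u = step_color g u v,
        forall v u c, step_color g v u = Some c -> u \in g v /\ c < 3,
        forall v u w c, step_color g v u = Some c -> step_color g v w = Some c -> u = w &
        forall v, #|uncolored step_color g v| <= d.-2].
Proof.
move=> d1; split=> [|g cg]; first exact: step_color_local.
split.
- exact: step_color_sym.
- by move=> v u c E; have := step_color_edge E; have := step_color_lt3 E.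
- exact: step_color_proper.
- by move=> v; apply: card_remainder.
Qed.

End Step.


(** * Iterating the step, with the bounds on radius and number of colors *)

Section Recursion.
Variables (V : finType) (m : nat) (key : V -> nat -> bool).
Hypothesis key_inj : forall u v, (forall b, b < m -> key u b = key v b) -> u = v.
Hypothesis card_V : #|V| <= 2 ^ m.
Hypothesis m_gt0 : 0 < m.
Implicit Types (g : graph V) (u v : V).

Lemma structure_radius_le D q b : D * q <= b -> 0 < b -> structure_radius D q <= 3 * b.
Proof. by rewrite /structure_radius; clear; lia. Qed.

Lemma step_radius_le d : 1 < d ->
  step_radius m (rank_bound d) (target_radius m d) <= 300 * (d * m).
Proof.
move=> d1; set x := d * m; set D := rank_bound d.
have x_d : d <= x by rewrite leq_pmulr.
have x_m : m <= x by rewrite leq_pmull // ltnW.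
have x0 : 0 < x by apply: leq_trans x_m.
have D3 : D <= 3 * d by rewrite /D /rank_bound; clear; lia.
have Dm : D * m <= 3 * x by rewrite mulnA leq_mul2r D3 orbT.
have mm : m * (d * 3) = 3 * x by rewrite mulnA (mulnC m) mulnC.
have mw : m * (4 * D) <= 12 * x.
  by rewrite mulnCA (mulnC m); move: Dm; clear; lia.
have s1 : structure_radius d.-1 m.+1 <= 3 * (2 * x).
  apply: structure_radius_le; last by move: x0; clear; lia.
  apply: (@leq_trans (d * m.+1)); first by rewrite leq_mul2r leq_pred orbT.
  by rewrite mulnS; move: x_d; rewrite /x; clear; lia.
have s2 : structure_radius D m.+2 <= 3 * (9 * x).
  apply: structure_radius_le; last by move: x0; clear; lia.
  by rewrite 2!mulnS; move: Dm D3 x_d; clear; lia.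
have ts : tail_size D <= 6 * x by rewrite /tail_size; move: D3 x_d; clear; lia.
rewrite /step_radius /pieces_radius /target_radius /piece_bound /half_length /core_radius.
rewrite /needy_radius /cover_radius /slot_radius /window_radius mm -/D.
by move: s1 s2 ts mw x_d x_m x0 D3; clear; lia.
Qed.

Lemma peeling d : 1 < d ->
  {S : graph V -> V -> {ffun V -> option nat} |
    local (@bounded_degree V d) (300 * (d * m)) S &
    forall g, bounded_degree d g ->
      [/\ forall v u, u \in g v -> S g v u = S g u v,
          forall v u c, S g v u = Some c -> u \in g v /\ c < 3,
          forall v u w c, S g v u = Some c -> S g v w = Some c -> u = w &
          forall v, #|uncolored S g v| <= d.-2]}.
Proof.
move=> d1.
have D0 := rank_bound_gt0 d1; have le_nt := needy_le_target m d.
have [] := @step_color_spec V m key key_inj d (rank_bound d) D0 (paths m key d)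
  (core m key d) (needy m key d) (target m key d) (target_radius m d).
- exact: local_le le_nt (paths_local key (d := d)).
- apply: local_le (core_local key (d := d)).
  apply: (@leq_trans (core_radius m d)); first exact: leq_addr.
  by rewrite /target_radius -addnA leq_addr.
- exact: local_le le_nt (needy_local key (d := d)).
- exact: target_local.
- by move=> g; apply: paths_sub.
- by move=> g; apply: paths_symg.
- by move=> g v u; rewrite inE.
- by move=> g v cg; apply: card_paths.
- by move=> g v cg; apply: needy_paths.
- by move=> g z p par cg; apply: window_untouched.
- by move=> g v cg; apply: residue2_le.
- by move=> g v cg; apply: residue2_light.
- by move=> g u v cg; apply: needy_indep.
- by move=> g n r _; apply: targetP.
- by move=> g n n' r _; apply: target_inj.
- by move=> g n cg; apply: target_total.
- exact: d1.
move=> lS spec; exists (step_color m key (rank_bound d) (paths m key d) (core m key d)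
   (needy m key d) (target m key d)); last exact: spec.
exact: local_le (step_radius_le d1) lS.
Qed.

Definition proper_labeling k g (F : V -> {ffun V -> nat}) : Prop :=
  [/\ forall v u, u \in g v -> F v u = F u v,
      forall v u, u \in g v -> F v u < k &
      forall v u w, u \in g v -> w \in g v -> F v u = F v w -> u = w].

Lemma uncolored_local d t (S : graph V -> V -> {ffun V -> option nat}) :
  local (@bounded_degree V d) t S -> local (@bounded_degree V d) t (uncolored S).
Proof.
move=> lS g g' x cg cg' ag; have gx : g x = g' x := ag x (ball_refl _ _ _).
by rewrite /uncolored (lS _ _ _ cg cg' ag) gx.
Qed.

(** Each step uses 3 colors and lowers the degree bound by 2, and
    [(3 * d.+2) %/ 2 = (3 * d) %/ 2 + 3]. The statement lives in [Type] so that the algorithm can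
    extract [F]. *)
Lemma edge_coloring d :
  {F : graph V -> V -> {ffun V -> nat} |
    local (@bounded_degree V d) (300 * (d ^ 2 * m)) F &
    forall g, bounded_degree d g -> proper_labeling ((3 * d) %/ 2) g (F g)}.
Proof.
(* Proving the claim for [d] and [d.+1] together turns the induction with step two into an ordinary
   one. *)
suff: {F : graph V -> V -> {ffun V -> nat} |
    local (@bounded_degree V d) (300 * (d ^ 2 * m)) F &
    forall g, bounded_degree d g -> proper_labeling ((3 * d) %/ 2) g (F g)} *
  {F : graph V -> V -> {ffun V -> nat} |
    local (@bounded_degree V d.+1) (300 * (d.+1 ^ 2 * m)) F &
    forall g, bounded_degree d.+1 g -> proper_labeling ((3 * d.+1) %/ 2) g (F g)} by case.
elim: d => [|d [[F lF pF] IH]]; split=> //.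
- exists (fun _ _ => [ffun=> 0]) => // g [_ g0].
  have none v u : u \in g v -> False.
    by have := g0 v; rewrite leqn0 cards_eq0 => /eqP ->; rewrite inE.
  by split=> [v u /none []|v u /none []|v u w /none []].
(* A graph of maximum degree 1 needs the single color [(3 * 1) %/ 2 = 1]. *)
- exists (fun _ _ => [ffun=> 0]) => // g [_ g1].
  split=> [v u _|v u _|v u w uv wv _]; rewrite ?ffunE //.
  by apply: (card_le1_eqP (g1 v)).
have [|S lS specS] := @peeling d.+2; first by [].
have clsS g : bounded_degree d.+2 g -> bounded_degree d (uncolored S g).
  move=> cg; have [symS _ _ cardS] := specS g cg; have [[sg ig] _] := cg.
  split; last by move=> v; apply: leq_trans (cardS v) _.
  split=> [x y|x]; last by rewrite inE (negPf (ig x)).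
  by rewrite !inE sg; case: (boolP (x \in g y)) => //= xy; rewrite (symS x y) // sg.
exists (fun g v => [ffun u => if S g v u is Some c then c else F (uncolored S g) v u + 3]).
  have lFS : local (@bounded_degree V d.+2) (300 * (d.+2 ^ 2 * m))
      (fun g => F (uncolored S g)).
    (* The radii of the step and of the recursive call add up, and
       [(d + 2) + d ^ 2 <= (d + 2) ^ 2]. *)
    apply: (local_le _ (local_sub clsS _ (uncolored_local lS) lF)) => [|g _ x].
      rewrite -mulnDr leq_mul2l -mulnDl leq_mul2r; apply/orP; right; apply/orP; right.
      by rewrite -2!mulnn; clear; nia.
    by apply/subsetP => u; rewrite inE => /andP[].
  move=> g g' x cg cg' ag; have Sx : S g x = S g' x.
    apply: lS => //; apply: agree_le ag; rewrite leq_mul2l leq_mul2r.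
    by apply/orP; right; apply/orP; right; rewrite -mulnn leq_pmulr.
  have Fx : F (uncolored S g) x = F (uncolored S g') x by apply: lFS.
  by rewrite Sx Fx.
move=> g cg; have [symS edgeS properS _] := specS g cg; have [[sg _] _] := cg.
have [symF ltF properF] := pF _ (clsS _ cg).
have unc v u : u \in g v -> S g v u = None -> u \in uncolored S g v.
  by move=> uv E; rewrite inE uv E.
have kE : (3 * d.+2) %/ 2 = (3 * d) %/ 2 + 3 by clear; lia.
split=> [v u uv|v u uv|v u w uv wv]; rewrite !ffunE.
- rewrite -(symS v u uv); case E: (S g v u) => [c|] //.
  by rewrite (symF v u (unc v u uv E)).
- rewrite kE; case E: (S g v u) => [c|].
    by have [_ lt3] := edgeS _ _ _ E; apply: leq_trans lt3 (leq_addl _ _).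
  by rewrite ltn_add2r ltF ?unc.
- case Eu: (S g v u) => [c|]; case Ew: (S g v w) => [c'|].
  + by move=> cc'; apply: properS Eu _; rewrite Ew cc'.
  + by move=> cE; have [_] := edgeS _ _ _ Eu; rewrite cE ltnNge leq_addl.
  + by move=> cE; have [_] := edgeS _ _ _ Ew; rewrite -cE ltnNge leq_addl.
  + by move=> /addIn; apply: properF; apply: unc.
Qed.

End Recursion.


(** * From local functions to a LOCAL algorithm: labels, flooding and correctness *)

Section Labels.
Variable m : nat.

(** Bit strings that stand for IDs. This vertex set depends only on [m], so every node knows it
    without knowing the network. *)
Definition label := {ffun 'I_m -> bool}.

Definition label_bit (v : label) (b : nat) : bool :=
  if insub b is Some i then v i else false.

Lemma label_bit_inj (u v : label) :
  (forall b, b < m -> label_bit u b = label_bit v b) -> u = v.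
Proof.
move=> uv; apply/ffunP => i; have := uv i (ltn_ord i).
by rewrite /label_bit valK.
Qed.

Lemma card_label : #|{: label}| = 2 ^ m.
Proof. by rewrite card_ffun card_bool card_ord. Qed.

Definition label_of (k : nat) : label := nth [ffun=> false] (enum label) k.

Lemma label_of_inj k l : k < 2 ^ m -> l < 2 ^ m -> label_of k = label_of l -> k = l.
Proof.
rewrite -card_label cardE => lt_k lt_l /eqP.
by rewrite nth_uniq ?enum_uniq // => /eqP.
Qed.

End Labels.

(** The first step of a walk is split off instead of the last one, which is how knowledge spreads:
    through the neighbors of the node that learns. *)
Lemma ballSl (V : finType) (g : graph V) k x y :
  y \in ball g k.+1 x -> exists2 x', x' = x \/ x' \in g x & y \in ball g k x'.
Proof.
elim: k y => [|k IH] y /ballSP[w wb wy].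
  rewrite inE in wb; move: wy; rewrite (eqP wb) => wy.
  by exists y => //; apply: ball_refl.
have [x' xx' wx'] := IH _ wb; exists x' => //.
by apply/ballSP; exists w.
Qed.

Section Simulation.
Variable c : nat.

(** IDs are at most [n ^ c], and [n < 2 ^ (trunc_log 2 n).+1]; the outer successor makes the bound
    on the IDs strict and the size positive. *)
Definition label_size n := (c * (trunc_log 2 n).+1).+1.

Definition color_radius n d := 300 * (d ^ 2 * label_size n).

(** The rows within distance [r] are known after [r + 1] rounds. Without edges the claimed time
    bound is 0, so the answer must be immediate. *)
Definition round_number n d := if d == 0 then 0 else (color_radius n d).+1.

Definition bounded_degreeb (V : finType) d (g : {ffun V -> {set V}}) :=
  [&& [forall x, forall y, (y \in g x) == (x \in g y)], [forall x, x \notin g x]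
    & [forall x, #|g x| <= d]].

Lemma bounded_degreebP (V : finType) d (g : {ffun V -> {set V}}) :
  reflect (bounded_degree d g) (bounded_degreeb d g).
Proof.
apply: (iffP and3P) => [[s i b]|[[s i] b]].
  split=> [|v]; last exact: (forallP b v).
  by split=> [x y|x]; [apply/eqP; apply: (forallP (forallP s x) y)|apply: (forallP i x)].
split; apply/forallP => x; rewrite ?i ?b //.
by apply/forallP => y; rewrite s.
Qed.

Definition consistent n (known : seq (nat * seq nat))
    (g : {ffun label (label_size n) -> {set label (label_size n)}}) :=
  all (fun p => g (label_of _ p.1) == [set x in [seq label_of _ b | b <- p.2]]) known.

Definition coloring n d : graph (label (label_size n)) ->
    label (label_size n) -> {ffun label (label_size n) -> nat} :=
  s2val (edge_coloring (@label_bit_inj (label_size n)) (eq_leq (card_label (label_size n)))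
    (ltn0Sn _) d).

Lemma coloring_local n d :
  local (@bounded_degree (label (label_size n)) d) (color_radius n d) (@coloring n d).
Proof. by rewrite /coloring; case: edge_coloring. Qed.

Lemma coloring_proper n d g : bounded_degree d g ->
  proper_labeling ((3 * d) %/ 2) g (@coloring n d g).
Proof. by rewrite /coloring; case: edge_coloring => F lF pF; apply: pF. Qed.

(* By locality, any graph that agrees with what a node has learned gives the
   node the same colors as the true graph. *)
Definition answer n d i (nbs : seq nat) known : seq nat :=
  let g := odflt [ffun=> set0]
    [pick g | bounded_degreeb d g && consistent (n := n) known g] in
  [seq coloring d g (label_of _ i) (label_of _ b) | b <- nbs].

Record node_state := NodeState {
  node_number : nat;
  degree_bound : nat;
  own_id : nat;
  rounds_done : nat;
  neighbor_ids : seq nat;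
  known_rows : seq (nat * seq nat);
  result : option (seq nat)
}.

Definition node_init n d i (_ : nat) : node_state :=
  NodeState n d i 0 [::] [::] (if d == 0 then Some [::] else None).

(** Full-information flooding: every message is the whole state of its sender, and the rows it
    contains are accumulated until the final round. *)
Definition node_receive s (ms : seq node_state) : node_state :=
  if result s is Some _ then s else
  let nbs := [seq own_id s' | s' <- ms] in
  let known := (own_id s, nbs) :: flatten [seq known_rows s' | s' <- ms] in
  let: NodeState n d i r _ _ _ := s in
  NodeState n d i r.+1 nbs known
    (if r.+1 == round_number n d then Some (answer n d i nbs known) else None).

Lemma node_result_final s ms o :
  result s = Some o -> result (node_receive s ms) = Some o.
Proof. by rewrite /node_receive => E; rewrite E. Qed.

Definition edge_coloring_algorithm : local_algorithm (seq nat) :=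
  {| init := node_init; send := fun s _ => s; receive := node_receive;
     output := result; output_final := node_result_final |}.

Section Run.
Variables (T : finType) (e : rel T) (ports : T -> seq T) (id : T -> nat).
Hypotheses (simple_e : simple_graph e) (ports_e : port_numbering e ports).
Hypothesis ids : unique_ids (#|T| ^ c) id.
Hypothesis edges_e : 0 < max_degree e.

Local Notation n := #|T|.
Local Notation d := (max_degree e).
Local Notation size_n := (label_size #|T|).
Local Notation A := edge_coloring_algorithm.

Definition vertex_label v : label size_n := label_of size_n (id v).

Lemma id_bound v : id v < 2 ^ size_n.
Proof.
have [_ id_le] := ids; have /andP[_ le_id] := id_le v; apply: leq_ltn_trans le_id _.
apply: (@leq_ltn_trans (2 ^ (c * (trunc_log 2 n).+1))); last by rewrite ltn_exp2l.
rewrite mulnC expnM; case: (c) => [|k]; first by [].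
by rewrite leq_exp2r // ltnW // trunc_log_ltn.
Qed.

Lemma vertex_label_inj : injective vertex_label.
Proof.
have [idI _] := ids; move=> u v uv; apply: idI.
exact: label_of_inj (id_bound u) (id_bound v) uv.
Qed.

(** The network copied to the labels; a label that belongs to no node is an isolated vertex. *)
Definition label_graph : {ffun label size_n -> {set label size_n}} :=
  [ffun x => [set y | [exists v, exists u, [&& vertex_label v == x, vertex_label u == y & e v u]]]].

Lemma label_graphP x y :
  reflect (exists v u, [/\ x = vertex_label v, y = vertex_label u & e v u]) (y \in label_graph x).
Proof.
rewrite ffunE inE; apply: (iffP existsP) => [[v /existsP[u /and3P[/eqP <- /eqP <- vu]]]|].
  by exists v, u.
by move=> [v [u [-> -> vu]]]; exists v; apply/existsP; exists u; rewrite !eqxx.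
Qed.

Lemma label_graph_edge v u : (vertex_label u \in label_graph (vertex_label v)) = e v u.
Proof.
apply/label_graphP/idP => [[v' [u' [/vertex_label_inj -> /vertex_label_inj -> //]]]|vu].
by exists v, u.
Qed.

Lemma label_graph_bounded : bounded_degree d label_graph.
Proof.
have [symE irrE] := simple_e; split; first split.
- move=> x y; apply/label_graphP/label_graphP => -[v [u [-> -> vu]]];
    by exists u, v; rewrite symE.
- move=> x; apply/label_graphP => -[v [u [-> /vertex_label_inj <-]]].
  by rewrite irrE.
move=> x; have [/existsP[v /eqP xE]|none] := boolP [exists v, vertex_label v == x]; last first.
  have -> : label_graph x = set0; last by rewrite cards0.
  apply/setP => y; rewrite [RHS]inE; apply/label_graphP => -[v [u [xE _ _]]].
  by case/existsP: none; exists v; rewrite xE.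
apply: (@leq_trans (degree e v)); last exact: (leq_bigmax v).
rewrite /degree -(card_imset _ vertex_label_inj); apply/subset_leq_card/subsetP => y.
move=> /label_graphP[v' [u [xE' -> vu]]]; apply/imsetP; exists u => //.
by rewrite inE; rewrite -xE in xE'; rewrite (vertex_label_inj xE').
Qed.

Fixpoint knowledge t v : seq (nat * seq nat) :=
  if t is t'.+1 then
    (id v, [seq id u | u <- ports v]) :: flatten [seq knowledge t' u | u <- ports v]
  else [::].

Lemma mem_ports v u : (u \in ports v) = e v u.
Proof. by have [_ ->] := ports_e v. Qed.

Lemma knowledge_sound t v p : p \in knowledge t v ->
  exists u, p = (id u, [seq id w | w <- ports u]).
Proof.
elim: t v => [|t IH] v //; rewrite inE => /orP[/eqP ->|]; first by exists v.
by move=> /flattenP[s /mapP[u _ ->]]; apply: IH.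
Qed.

Lemma knowledge_complete k t v y : k < t -> y \in ball label_graph k (vertex_label v) ->
  exists2 u, y = vertex_label u & (id u, [seq id w | w <- ports u]) \in knowledge t v.
Proof.
elim: k t v => [|k IH] [|t] v // lt_kt.
  by rewrite inE => /eqP ->; exists v; rewrite // mem_head.
case/ballSl => x' [->|/label_graphP[v' [u [/vertex_label_inj <- -> vu]]]] yb.
  exact: IH (ltnW lt_kt) yb.
have [w yE wk] := IH t u lt_kt yb; exists w => //.
rewrite inE; apply/orP; right; apply/flattenP; exists (knowledge t u) => //.
by apply: map_f; rewrite mem_ports.
Qed.

Lemma row_label_graph v : label_graph (vertex_label v) =
  [set x in [seq label_of size_n b | b <- [seq id u | u <- ports v]]].
Proof.
apply/setP => y; rewrite inE -map_comp; apply/label_graphP/mapP.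
  move=> [v' [u [/vertex_label_inj <- -> vu]]]; exists u => //.
  by rewrite mem_ports.
by move=> [u uv ->]; exists v, u; rewrite -mem_ports.
Qed.

Lemma knowledge_consistent t v : consistent (n := n) (knowledge t v) label_graph.
Proof.
by apply/allP => p /knowledge_sound[u ->] /=; rewrite -row_label_graph.
Qed.

Definition node_color v u : nat :=
  coloring d label_graph (vertex_label v) (vertex_label u).

Lemma answer_correct v :
  answer n d (id v) [seq id u | u <- ports v] (knowledge (color_radius n d).+1 v) =
  [seq node_color v u | u <- ports v].
Proof.
(* The pick succeeds because [label_graph] itself passes the test. *)
rewrite /answer; case: pickP => [g /andP[/bounded_degreebP bg cons]|/(_ label_graph)]; last first.
  by rewrite knowledge_consistent andbT => /bounded_degreebP; case; apply: label_graph_bounded.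
rewrite -map_comp; apply: eq_map => u /=; rewrite /node_color.
rewrite -/(vertex_label v) -/(vertex_label u); congr (fun_of_fin _ _).
apply/esym/(coloring_local label_graph_bounded bg) => y.
case/(knowledge_complete (ltnSn _)) => w -> /(allP cons) /= /eqP ->.
exact: row_label_graph.
Qed.

Lemma state_before t v : t <= color_radius n d ->
  state_after A e ports id t v =
  NodeState n d (id v) t (if t is 0 then [::] else [seq id u | u <- ports v])
    (knowledge t v) None.
Proof.
have dn0 : (d == 0) = false by rewrite eqn0Ngt edges_e.
elim: t v => [|t IH] v lt_t; first by rewrite /= /node_init dn0.
have mE : [seq send (state_after A e ports id t u) (index v (ports u)) | u <- ports v] =
    [seq NodeState n d (id u) t (if t is 0 then [::] else [seq id w | w <- ports u])
      (knowledge t u) None | u <- ports v].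
  by apply: eq_map => u; rewrite /= IH // ltnW.
rewrite [LHS]/= mE IH ?(ltnW lt_t) // /node_receive /= -!map_comp.
by rewrite /round_number dn0 eqSS ltn_eqF.
Qed.

Lemma output_at_round v :
  output_after A e ports id (round_number n d) v = Some [seq node_color v u | u <- ports v].
Proof.
have dn0 : (d == 0) = false by rewrite eqn0Ngt edges_e.
have rE : round_number n d = (color_radius n d).+1 by rewrite /round_number dn0.
rewrite rE -answer_correct /output_after; set r := color_radius n d.
have mE : [seq send (state_after A e ports id r u) (index v (ports u)) | u <- ports v] =
    [seq NodeState n d (id u) r (if r is 0 then [::] else [seq id w | w <- ports u])
      (knowledge r u) None | u <- ports v].
  by apply: eq_map => u; rewrite /= state_before.
rewrite [state_after _ _ _ _ _ _]/= mE state_before // /node_receive /= -!map_comp.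
by rewrite rE eqxx.
Qed.

(** One of the two orders of the endpoints is picked; by [node_colorC] the choice does not
    matter. *)
Definition set_color (E : {set T}) : nat :=
  if [pick p : T * T | e p.1 p.2 && (E == [set p.1; p.2])] is Some p
  then node_color p.1 p.2 else 0.

Lemma node_color_proper : proper_labeling ((3 * d) %/ 2) label_graph (coloring d label_graph).
Proof. exact: coloring_proper label_graph_bounded. Qed.

Lemma node_colorC v u : e v u -> node_color v u = node_color u v.
Proof. by have [symF _ _] := node_color_proper; move=> vu; apply: symF; rewrite label_graph_edge. Qed.

Lemma node_color_lt v u : e v u -> node_color v u < (3 * d) %/ 2.
Proof. by have [_ ltF _] := node_color_proper; move=> vu; apply: ltF; rewrite label_graph_edge. Qed.

Lemma node_color_inj v u w : e v u -> e v w -> node_color v u = node_color v w -> u = w.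
Proof.
have [_ _ properF] := node_color_proper => vu vw cE; apply: vertex_label_inj.
by apply: properF cE; rewrite label_graph_edge.
Qed.

Lemma set_color_edge v u : e v u -> set_color [set v; u] = node_color v u.
Proof.
move=> vu; rewrite /set_color; case: pickP => [[a b] /andP[/= ab /eqP E]|/(_ (v, u))]; last first.
  by rewrite /= vu eqxx.
have [_ irrE] := simple_e.
have neq_ab : a != b by apply: contraTneq ab => ->; rewrite irrE.
have : v \in [set a; b] by rewrite -E !inE eqxx.
have : u \in [set a; b] by rewrite -E !inE eqxx orbT.
have neq_vu : v != u by apply: contraTneq vu => ->; rewrite irrE.
rewrite !inE => /orP[] /eqP uE /orP[] /eqP vE.
- by rewrite uE vE eqxx in neq_vu.
- by rewrite uE vE node_colorC.
- by rewrite uE vE.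
- by rewrite uE vE eqxx in neq_vu.
Qed.

Lemma edges_at x (E : {set T}) : E \in edges e -> x \in E ->
  exists2 u, e x u & E = [set x; u].
Proof.
have [symE _] := simple_e => /imsetP[[v u]]; rewrite inE /= => vu -> /set2P[] ->.
  by exists u.
by exists v; rewrite 1?symE // setUC.
Qed.

Lemma set_color_proper : proper_edge_coloring e ((3 * d) %/ 2) set_color.
Proof.
split=> [E /imsetP[[v u]]|E E' Ee E'e neq /set0Pn[x /setIP[xE xE']]].
  by rewrite inE /= => vu ->; rewrite set_color_edge // node_color_lt.
have [u xu Eu] := edges_at Ee xE; have [w xw Ew] := edges_at E'e xE'.
rewrite Eu Ew !set_color_edge //; apply: contraNneq neq => cE.
by rewrite Eu Ew (node_color_inj xu xw cE).
Qed.

End Run.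

(** With [L = trunc_log 2 n] positive, [c * (L + 1) + 1 <= (2 * c + 1) * L]; raising 300 to 301
    absorbs the additional round. *)
Lemma round_number_le n d : 1 < n -> 
  round_number n d <= 301 * (2 * c).+1 * (d ^ 2 * trunc_log 2 n).
Proof.
move=> n1; rewrite /round_number; case: eqP => // /eqP; rewrite -lt0n => d0.
have L0 : 0 < trunc_log 2 n by rewrite trunc_log_gt0.
have d2 : 0 < d ^ 2 by rewrite expn_gt0 d0.
have le_m : label_size n <= (2 * c).+1 * trunc_log 2 n.
  by rewrite /label_size; move: L0; clear; nia.
have le_r : color_radius n d <= 300 * (d ^ 2 * ((2 * c).+1 * trunc_log 2 n)).
  by rewrite !leq_mul2l le_m !orbT.
have pos : 0 < d ^ 2 * ((2 * c).+1 * trunc_log 2 n) by rewrite muln_gt0 d2 muln_gt0 L0.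
have -> : 301 * (2 * c).+1 * (d ^ 2 * trunc_log 2 n) =
    301 * (d ^ 2 * ((2 * c).+1 * trunc_log 2 n)) by rewrite -mulnA; congr muln; rewrite mulnCA.
by move: le_r pos; clear; lia.
Qed.

End Simulation.

Theorem theorem1p2 :
  forall c : nat,
  exists (A : local_algorithm (seq nat)) (C : nat),
  forall (T : finType) (e : rel T) (ports : T -> seq T) (id : T -> nat),
    simple_graph e ->
    port_numbering e ports ->
    unique_ids (#|T| ^ c) id ->
    exists2 t : nat,
      t <= C * (max_degree e ^ 2 * trunc_log 2 #|T|) &
      edge_colors_within A e ports id ((3 * max_degree e) %/ 2) t.
Proof.
move=> c; exists (edge_coloring_algorithm c), (301 * (2 * c).+1).
move=> T e ports id simple_e ports_e ids.
have [d0|d0] := posnP (max_degree e).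
  have none v u : e v u = false.
    apply/negP => vu; have := leq_bigmax (F := degree e) v.
    rewrite -/(max_degree e) d0 leqn0 cards_eq0 => /eqP/setP/(_ u).
    by rewrite !inE vu.
  exists 0 => //; exists (fun=> 0) => [|v].
    by split=> [E|E E'] /imsetP[[v u]]; rewrite inE none.
  have -> : ports v = [::].
    case E: (ports v) => [|u s] //; have [_ /(_ u)] := ports_e v.
    by rewrite E mem_head inE none.
  by rewrite /output_after /= /node_init d0.
(* An edge has two distinct endpoints, so the logarithm in the time bound is positive. *)
have T1 : 1 < #|T|.
  have [v dv] : exists v, 0 < degree e v.
    have [/existsP[v dv]|] := boolP [exists v, 0 < degree e v]; first by exists v.
    rewrite negb_exists => /forallP none; move: d0.
    by rewrite /max_degree big1 // => v _; apply/eqP; rewrite -leqn0 leqNgt.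
  have /card_gt0P[u] := dv; rewrite inE => vu.
  apply/card_gt1P; exists v, u; split=> //.
  by apply: contraTneq vu => ->; have [_ ->] := simple_e.
exists (round_number c #|T| (max_degree e)); first exact: round_number_le.
exists (set_color c e id); first exact: set_color_proper.
move=> v; rewrite output_at_round //; congr Some; apply/eq_in_map => u uv.
rewrite set_color_edge //.
by have [_ /(_ u)] := ports_e v; rewrite uv inE => <-.
Qed.
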